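(* Let $d\ge2$ and let $\nu\in\mathcal M_2(\Omega_d)$ have equal marginals ${\pi_i}_\#\nu=\overline\nu$ on $\Omega_1$ for $i=1,\dots,d$. Then $$\mathcal W_*(\nu,\nu^{\mathrm{co}})\le\mathcal W_*(\nu^\perp,\nu^{\mathrm{co}}).$$ If $\overline\nu(\Omega_1)=+\infty$, then equality holds if and only if $\nu=\nu^\perp$.
   Context: $\Omega_d=[0,+\infty)^d\setminus\{\mathbf 0\}$, so $\Omega_1=(0,+\infty)$. $\mathcal M_2(\Omega_d)$ is the set of positive Borel measures $\nu$ on $\Omega_d$ (possibly of infinite mass) with $\int_{\Omega_d}\|\mathbf s\|^2d\nu(\mathbf s)<+\infty$. For measures on $\Omega_d$, ${\pi_i}_\#\nu$ is the pushforward by the $i$-th coordinate map, restricted to $\Omega_1$. Given $\overline\nu\in\mathcal M_2(\Omega_1)$: $\nu^{\mathrm{co}}$ is the pushforward of $\overline\nu$ by $s\mapsto(s,\dots,s)\in\Omega_d$, and $\nu^\perp=\sum_{j=1}^d (s\mapsto s\,e_j)_\#\overline\nu$, with $e_j$ the $j$-th standard basis vector. Extended Wasserstein distance: for $\nu^1,\nu^2\in\mathcal M_2(\Omega_d)$ let $\overline\Gamma(\nu^1,\nu^2)$ be the set of $\gamma\in\mathcal M_2(\Omega_{2d})$ such that the pushforwards of $\gamma$ by $(\mathbf s,\mathbf s')\mapsto\mathbf s$ and $(\mathbf s,\mathbf s')\mapsto\mathbf s'$, restricted to $\Omega_d$, equal $\nu^1$ and $\nu^2$ respectively. Then $\mathcal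 W_*(\nu^1,\nu^2)^2=\inf_{\gamma\in\overline\Gamma(\nu^1,\nu^2)}\iint_{\Omega_{2d}}\|\mathbf s-\mathbf s'\|^2\,d\gamma(\mathbf s,\mathbf s')$. *)

(* Defs.v *)
From HB Require Import structures.
From mathcomp Require Import all_boot all_order all_algebra.
From mathcomp Require Import all_classical all_reals all_analysis.

Set Implicit Arguments.
Unset Strict Implicit.
Unset Printing Implicit Defensive.

Import Order.TTheory GRing.Theory Num.Theory.

Local Open Scope classical_set_scope.
Local Open Scope ring_scope.

(* R^d is [d.-tuple R], whose measurable structure (the sigma-algebra generated
   by the coordinate maps) is the Borel sigma-algebra.  A Borel measure on a
   Borel subset Omega of R^d is represented by the measure on R^d it induces,
   i.e. by a measure on R^d that vanishes on the complement of Omega. *)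

Section Definitions.
Context {R : realType}.

Definition Omega (d : nat) : set (d.-tuple R) :=
  [set s | (forall i, 0 <= tnth s i) /\ exists i, tnth s i != 0].

Arguments Omega : clear implicits.

(* Omega_1, as a subset of R rather than of 1.-tuple R *)
Definition Omega1 : set R := [set s | 0 < s].

Definition sqnorm (d : nat) (s : d.-tuple R) : R := \sum_(i < d) tnth s i ^+ 2.

Definition inM2 (d : nat) (nu : {measure set (d.-tuple R) -> \bar R}) : Prop :=
  nu (~` Omega d) = 0%E /\ (\int[nu]_(s in Omega d) (sqnorm s)%:E < +oo)%E.

Definition inM2_1 (nu : {measure set R -> \bar R}) : Prop :=
  nu (~` Omega1) = 0%E /\ (\int[nu]_(s in Omega1) (s ^+ 2)%:E < +oo)%E.

(* The pushforward may charge 0, so it is compared with [nubar] on Omega_1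
   only. *)
Definition has_marginals (d : nat) (nu : {measure set (d.-tuple R) -> \bar R})
    (nubar : {measure set R -> \bar R}) : Prop :=
  forall (i : 'I_d) (A : set R), measurable A -> A `<=` Omega1 ->
    pushforward nu (fun s => tnth s i) A = nubar A.

Definition diag (d : nat) (s : R) : d.-tuple R := [tuple s | i < d].

Definition axis (d : nat) (j : 'I_d) (s : R) : d.-tuple R :=
  [tuple if i == j then s else 0 | i < d].

Lemma measurable_diag (d : nat) : measurable_fun [set: R] (@diag d).
Proof.
apply/measurable_fun_tnthP => i.
rewrite (_ : _ \o _ = id)//.
by apply/funext => s /=; rewrite tnth_mktuple.
Qed.

Lemma measurable_axis (d : nat) (j : 'I_d) : measurable_fun [set: R] (axis j).
Proof.
apply/measurable_fun_tnthP => i.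
rewrite (_ : _ \o _ = fun s => if i == j then s else 0); last first.
  by apply/funext => s /=; rewrite tnth_mktuple.
by case: (i == j).
Qed.

Definition nu_co (d : nat) (nubar : {measure set R -> \bar R})
    : set (d.-tuple R) -> \bar R :=
  pushforward nubar (@diag d).

Definition nu_perp (d : nat) (nubar : {measure set R -> \bar R})
    (A : set (d.-tuple R)) : \bar R :=
  (\sum_(j < d) pushforward nubar (axis j) A)%E.

Section measures.
Local Open Scope ereal_scope.
Variables (d : nat) (nubar : {measure set R -> \bar R}).

(* [pushforward] along a measurable map, packed as a measure *)
Let push (f : R -> d.-tuple R) (mf : measurable_fun [set: R] f) :
    {measure set (d.-tuple R) -> \bar R} :=
  measure_function_pushforward__canonical__measure_function_Measure nubar mf.

HB.instance Definition _ := isMeasure.Build _ _ _ (nu_co nubar)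
  (@measure0 _ _ _ (push (@measurable_diag d)))
  (@measure_ge0 _ _ _ (push (@measurable_diag d)))
  (@measure_semi_sigma_additive _ _ _ (push (@measurable_diag d))).

Let nu_perp0 : @nu_perp d nubar set0 = 0.
Proof.
by rewrite /nu_perp big1// => j _; exact: (measure0 (push (measurable_axis j))).
Qed.

Let nu_perp_ge0 A : 0 <= @nu_perp d nubar A.
Proof.
by apply: sume_ge0 => j _; exact: (measure_ge0 (push (measurable_axis j))).
Qed.

Let nu_perp_sigma_additive : semi_sigma_additive (@nu_perp d nubar).
Proof.
move=> F mF tF mUF; rewrite [X in _ --> X](_ : _ =
    lim ((fun n => \sum_(0 <= i < n) @nu_perp d nubar (F i)) @ \oo)%classic).
  by apply: is_cvg_ereal_nneg_natsum => k _; exact: nu_perp_ge0.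
rewrite nneseries_sum/=; last first.
  by move=> i j _; exact: (measure_ge0 (push (measurable_axis i))).
apply: eq_bigr => /= j _.
exact: (@measure_semi_bigcup _ _ _ (push (measurable_axis j))).
Qed.

HB.instance Definition _ := isMeasure.Build _ _ _ (@nu_perp d nubar)
  nu_perp0 nu_perp_ge0 nu_perp_sigma_additive.

End measures.

Definition fst_part (d : nat) (z : (d + d).-tuple R) : d.-tuple R :=
  [tuple tnth z (lshift d i) | i < d].

Definition snd_part (d : nat) (z : (d + d).-tuple R) : d.-tuple R :=
  [tuple tnth z (rshift d i) | i < d].

Definition tsub (d : nat) (s t : d.-tuple R) : d.-tuple R :=
  [tuple tnth s i - tnth t i | i < d].

(* Either projection of [gamma] may charge the origin of R^d, with possibly
   infinite mass, which the restriction to Omega_d ignores. *)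
Definition couplings (d : nat) (nu1 nu2 : {measure set (d.-tuple R) -> \bar R})
    : set {measure set ((d + d).-tuple R) -> \bar R} :=
  [set gamma | [/\ inM2 gamma,
    forall A : set (d.-tuple R), measurable A -> A `<=` Omega d ->
      pushforward gamma (@fst_part d) A = nu1 A &
    forall A : set (d.-tuple R), measurable A -> A `<=` Omega d ->
      pushforward gamma (@snd_part d) A = nu2 A]].

Definition Wstar (d : nat) (nu1 nu2 : {measure set (d.-tuple R) -> \bar R})
    : \bar R :=
  sqrte (ereal_inf
    [set (\int[gamma]_(z in Omega (d + d))
            (sqnorm (tsub (fst_part z) (snd_part z)))%:E)%E
    | gamma in couplings nu1 nu2]).

End Definitions.

Arguments Omega {R} d.
Arguments nu_co {R} d nubar.
Arguments nu_perp {R} d nubar.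

(* Main.v *)
Require Import Defs.
From HB Require Import structures.
From mathcomp Require Import all_boot all_order all_algebra.
From mathcomp Require Import all_classical all_reals all_analysis.
From mathcomp Require Import measurable_realfun lra.

Set Implicit Arguments.
Unset Strict Implicit.
Unset Printing Implicit Defensive.

Import Order.TTheory GRing.Theory Num.Theory.

Local Open Scope classical_set_scope.
Local Open Scope ring_scope.
Local Open Scope ereal_scope.

(** If [gamma] couples [nu] with [nu_co], its second component is almost surely
    a constant vector (t, ..., t), so with S = s_1 + ... + s_d the cost is a
    quantity depending only on the marginals minus twice the integral of S t.
    By the layer cake formula that integral is the integral over y > 0 of
    F(y) := the integral of S over {t > y}.  For every threshold a >= 0,
    S 1_{t > y} <= a 1_{t > y} + (S - a)_+ gives
      F(y) <= a nubar(]y, oo[) + integral of (S - a)_+ dnu,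
    with equality if {S > a} <= {t > y} <= {S >= a}; a monotone (quantile)
    coupling achieves the equality for all y at once, with thresholds a(y).
    Now (S - a)_+ >= sum_i (s_i - a)_+ pointwise, with equality on the axes, and
    the integral of the right-hand side depends only on the marginals; so at each
    level y the quantile coupling of [nu] beats every coupling of [nu_perp].
    When nubar has infinite mass, 0 < a(y) and a(y) -> 0 as y -> 0, whereas
    (S - a)_+ >= sum_i (s_i - a)_+ + a as soon as two coordinates are >= a.  If
    [nu] charges the points with two positive coordinates, the gap is therefore
    bounded below on an interval of levels y, uniformly in the coupling of
    [nu_perp]; no optimal coupling of [nu_perp] is needed. *)

(** * Marginals and layer cake *)

(* Mass sent outside [DY] (for us, to the origin) is ignored because [f] vanishes
   there. *)
Lemma ge0_integral_marginal (R : realType) d1 d2 (X : measurableType d1)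
    (Y : measurableType d2) (mu : {measure set X -> \bar R})
    (m : {measure set Y -> \bar R}) (g : X -> Y) (DX : set X) (DY : set Y)
    (f : Y -> \bar R) :
  measurable_fun setT g -> measurable DX -> measurable DY -> mu (~` DX) = 0 ->
  (forall A, measurable A -> A `<=` DY -> pushforward mu g A = m A) ->
  measurable_fun setT f -> (forall y, DY y -> 0 <= f y) ->
  (forall x, DX x -> ~ DY (g x) -> f (g x) = 0) ->
  \int[mu]_(x in DX) f (g x) = \int[m]_(y in DY) f y.
Proof.
move=> mg mDX mDY muDX pushE mf f0 fg0.
pose push : {measure set Y -> \bar R} :=
  measure_function_pushforward__canonical__measure_function_Measure mu mg.
have mgDY : measurable (g @^-1` DY) by rewrite -[X in measurable X]setTI; exact: (mg measurableT).
transitivity (\int[push]_(y in DY) f y); last exact: eq_measure_integral.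
rewrite [RHS]ge0_integral_pushforward//; last 2 first.
- exact: measurable_funTS.
- by move=> y /[!inE]; exact: f0.
rewrite [RHS](@ge0_negligible_integral _ _ _ mu (g @^-1` DY) (~` DX))//; last 3 first.
- exact: measurableC.
- by apply: measurable_funTS; exact: measurableT_comp.
- by move=> x; exact: f0.
rewrite setDE setCK setIC [RHS]integral_mkcondr; apply: eq_integral => x.
rewrite inE patchE => DXx; case: ifPn => //= /negP; rewrite inE.
exact: fg0.
Qed.

(** On [D], [h x] is the length of ]0, h x[, and Tonelli exchanges the two integrals; this is where
    sigma-finiteness of [mu] enters. *)
Lemma ge0_integral_layer_cake (R : realType) d (X : measurableType d)
    (mu : {sigma_finite_measure set X -> \bar R}) (D : set X) (g h : X -> R) :
  measurable D -> measurable_fun setT g -> measurable_fun setT h ->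
  (forall x, D x -> (0 <= g x)%R) -> (forall x, D x -> (0 <= h x)%R) ->
  \int[mu]_(x in D) (g x * h x)%:E =
  \int[lebesgue_measure]_(y in `]0%R, +oo[)
     \int[mu]_(x in D) (if (y < h x)%R then g x else 0%R)%:E.
Proof.
move=> mD mg mh g0 h0.
(* The restrictions to [D] and to positive [y] are moved into the integrand, so that Tonelli applies
   on the whole product. *)
pose F (z : X * R) := (if (0 < z.2 < h z.1)%R then \1_D z.1 * g z.1 else 0)%R.
have F0 z : (0 <= F z)%R.
  rewrite /F; case: ifPn => // _; rewrite indicE.
  by case: (boolP (z.1 \in D)) => [/[!inE] /g0|]; rewrite ?mul1r// mul0r.
have mF : measurable_fun setT F.
  apply: measurable_fun_ifT => //; last first.
    apply: measurable_funM; last exact: measurableT_comp.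
    by apply: measurableT_comp => //; exact: measurable_indic.
  by apply: measurable_and; apply: measurable_fun_ltr => //; exact: measurableT_comp.
have mEF : measurable_fun setT (fun z => (F z)%:E) by exact/measurable_EFinP.
transitivity (\int[mu]_x \int[lebesgue_measure]_y (F (x, y))%:E).
  rewrite integral_mkcond; apply: eq_integral => x _; rewrite patchE.
  rewrite (_ : (fun y => (F (x, y))%:E) =
      fun y => (\1_D x * g x)%R%:E * (\1_`]0%R, h x[ y)%:E); last first.
    apply/funext => y; rewrite /F /= [\1_(`]_, _[) _]indicE mem_setE in_itv/=.
    by case: ifPn; rewrite ?mule0// mule1.
  rewrite ge0_integralZl//; last 2 first.
    by apply: measurableT_comp => //; apply: measurable_indic; exact: measurable_itv.
    by rewrite lee_fin indicE; case: (boolP (x \in D)) => [/[!inE] /g0|]; rewrite ?mul1r// mul0r.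
  rewrite integral_indic//=.
  rewrite setIT lebesgue_measure_itv/= lte_fin.
  rewrite indicE; case: (boolP (x \in D)) => [/[!inE] Dx|]; last by rewrite mul0r mul0e.
  rewrite mul1r; case: ifPn; first by rewrite oppr0 adde0 EFinM.
  rewrite -leNgt => hx; have -> : h x = 0%R by apply/eqP; rewrite eq_le hx h0.
  by rewrite mulr0 mule0.
rewrite (@fubini_tonelli _ _ _ _ _ mu lebesgue_measure (fun z => (F z)%:E)); [|exact: mEF|by move=> z; rewrite lee_fin].
rewrite [RHS]integral_mkcond; apply: eq_integral => y _.
rewrite patchE mem_setE in_itv/= andbT; case: ifPn => y0.
  rewrite [RHS]integral_mkcond; apply: eq_integral => x _.
  rewrite patchE /F/= y0/= indicE; case: ifPn => xD; case: ifPn => //.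
    by rewrite mul1r.
  by rewrite mul0r.
by apply: integral0_eq => x _; rewrite /F/= (negbTE y0).
Qed.

Lemma measurable_layer (R : realType) d (X : measurableType d)
    (mu : {sigma_finite_measure set X -> \bar R}) (D : set X) (g h : X -> R) :
  measurable D -> measurable_fun setT g -> measurable_fun setT h ->
  (forall x, D x -> (0 <= g x)%R) ->
  measurable_fun [set: R]
    (fun y => \int[mu]_(x in D) (if (y < h x)%R then g x else 0%R)%:E).
Proof.
move=> mD mg mh g0.
pose F (z : X * R) := (if (z.2 < h z.1)%R then \1_D z.1 * g z.1 else 0)%R.
have F0 z : (0 <= F z)%R.
  rewrite /F; case: ifPn => // _; rewrite indicE.
  by case: (boolP (z.1 \in D)) => [/[!inE] /g0|]; rewrite ?mul1r// mul0r.
have mF : measurable_fun setT F.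
  apply: measurable_fun_ifT => //; last first.
    apply: measurable_funM; last exact: measurableT_comp.
    by apply: measurableT_comp => //; exact: measurable_indic.
  by apply: measurable_fun_ltr => //; exact: measurableT_comp.
have mEF : measurable_fun setT (fun z => (F z)%:E) by exact/measurable_EFinP.
have E0 z : 0 <= (F z)%:E by rewrite lee_fin.
have := @measurable_fun_fubini_tonelli_G _ _ _ _ _ mu (fun z => (F z)%:E) mEF E0.
congr (measurable_fun _ _); apply/funext => y.
rewrite /fubini_G/= [RHS]integral_mkcond; apply: eq_integral => x _.
rewrite patchE /F/= indicE; case: ifPn => xD; case: ifPn => //.
  by rewrite mul1r.
by rewrite mul0r.
Qed.

(** Both measures may be infinite near 0, so uniqueness on the pi-system of rays is applied after
    restriction to ]1/(n+1), oo[, where rays have finite mass; continuity from below then reaches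
    all of ]0, oo[. *)
Lemma measure_eq_on_pos (R : realType) (m1 m2 : {measure set R -> \bar R}) :
  (forall y : R, (0 < y)%R -> m1 `]y, +oo[%classic = m2 `]y, +oo[%classic) ->
  (forall y : R, (0 < y)%R -> m1 `]y, +oo[%classic < +oo) ->
  forall A, measurable A -> A `<=` Omega1 -> m1 A = m2 A.
Proof.
move=> m12 m1oo A mA A0.
pose I n : set R := `]n.+1%:R^-1%R, +oo[%classic.
have mI n : measurable (I n) by exact: measurable_itv.
have stepE n : m1 (A `&` I n) = m2 (A `&` I n).
  pose r1 : {measure set R -> \bar R} := mrestr m1 (mI n).
  pose r2 : {measure set R -> \bar R} := mrestr m2 (mI n).
  have rayI y : `]y, +oo[%classic `&` I n = `]Num.max y n.+1%:R^-1%R, +oo[%classic.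
    by apply/seteqP; split => x; rewrite /I/= !in_itv/= !andbT gt_max => /andP.
  have rayn y : (0 < Num.max y n.+1%:R^-1 :> R)%R.
    by rewrite lt_max invr_gt0 ltr0n orbT.
  apply: (@measure_unique _ R _ (@RGenOInfty.G R) (fun n => `](- n%:R)%R, +oo[%classic)
     _ _ _ _ r1 r2 _ _ A mA).
  - exact: RGenOInfty.measurableE.
  - move=> _ _ [x ->] [y ->]; exists (Num.max x y).
    by apply/seteqP; split => z /=; rewrite !in_itv/= !andbT gt_max => /andP.
  - by move=> k; eexists.
  - rewrite -subTset => x _; have [k kx] : exists k : nat, (- k%:R < x)%R.
      exists (Num.truncn `|x|%R).+1; rewrite ltrNl.
      by rewrite (le_lt_trans _ (truncnS_gt _))// -normrN ler_norm.
    by exists k => //=; rewrite in_itv/= kx.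
  - by move=> _ [y ->]; rewrite /r1/= /r2/= /mrestr rayI m12.
  - by move=> k; rewrite /r1/= /mrestr rayI m1oo.
have mAI n : measurable (A `&` I n) by exact: measurableI.
have cover : A = \bigcup_n (A `&` I n).
  apply/seteqP; split => [x Ax|x [n _ []]//].
  have x0 : (0 < x)%R := A0 _ Ax.
  have [k kx] : exists k : nat, (k.+1%:R^-1 < x)%R.
    exists (Num.truncn x^-1); rewrite invf_plt ?posrE ?ltr0n//; exact: truncnS_gt.
  by exists k => //; split => //=; rewrite /I/= in_itv/= kx.
have ndAI : nondecreasing_seq (fun n => A `&` I n).
  move=> i j ij; apply/subsetPset => x [Ax Ix]; split => //; move: Ix.
  rewrite /I/= !in_itv/= !andbT; apply: le_lt_trans.
  by rewrite lef_pV2 ?posrE ?ltr0n// ler_nat.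
have mU : measurable (\bigcup_n (A `&` I n)) by rewrite -cover.
have c1 := nondecreasing_cvg_mu (mu := m1) mAI mU ndAI.
have c2 := nondecreasing_cvg_mu (mu := m2) mAI mU ndAI.
rewrite cover -(cvg_lim _ c1)// -(cvg_lim _ c2)//.
by congr (limn _); apply/funext => n /=; exact: stepE.
Qed.

(** * The excess over a threshold *)

Definition tsum (R : realType) d (s : d.-tuple R) : R := (\sum_(i < d) tnth s i)%R.

Definition excess (R : realType) (a x : R) : R := Num.max (x - a)%R 0%R.

Lemma excess_ge0 (R : realType) (a x : R) : (0 <= excess a x)%R.
Proof. by rewrite /excess le_max lexx orbT. Qed.

Lemma excess_le (R : realType) (a x : R) : (0 <= a)%R -> (0 <= x)%R -> (excess a x <= x)%R.
Proof. by move=> a0 x0; rewrite /excess ge_max x0 andbT gerBl. Qed.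

Lemma le_excess (R : realType) (a x : R) : (x - a <= excess a x)%R.
Proof. by rewrite /excess le_max lexx. Qed.

Lemma measurable_excess (R : realType) (a : R) : measurable_fun setT (excess a).
Proof. by apply: measurable_maxr => //; apply: measurable_funB. Qed.

(** If some s_i exceeds [a], that coordinate alone accounts for the loss of [a] on the right, and
    every other excess is at most its coordinate. If none does, the left-hand side is 0. *)
Lemma sum_excess_le (R : realType) d (s : d.-tuple R) (a : R) :
  (0 <= a)%R -> (forall i, 0 <= tnth s i)%R ->
  (\sum_(i < d) excess a (tnth s i) <= excess a (tsum s))%R.
Proof.
move=> a0 s0.
have [/existsP[i ai]|/existsPn h] := boolP [exists i, (a < tnth s i)%R].
  apply: (le_trans _ (le_excess _ _)).
  rewrite /tsum (bigD1 i)//= [X in (_ <= X - _)%R](bigD1 i)//= addrAC lerD//.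
    by rewrite /excess max_l// subr_ge0 ltW.
  by apply: ler_sum => j _; exact: excess_le.
rewrite big1 ?excess_ge0// => i _; rewrite /excess max_r// subr_le0 leNgt; exact: h.
Qed.

(** On the left both coordinates [i] and [j] lose [a], whereas the sum on the right loses it only
    once. *)
Lemma sum_excess_gap (R : realType) d (s : d.-tuple R) (a : R) (i j : 'I_d) :
  (0 <= a)%R -> (forall i, 0 <= tnth s i)%R -> i != j ->
  (a <= tnth s i)%R -> (a <= tnth s j)%R ->
  (\sum_(i < d) excess a (tnth s i) + a <= excess a (tsum s))%R.
Proof.
move=> a0 s0 ij ai aj; apply: (le_trans _ (le_excess _ _)).
have -> : (tsum s = tnth s i + (tnth s j + \sum_(k < d | (k != i) && (k != j)) tnth s k))%R.
  by rewrite /tsum (bigD1 i)//= (bigD1 j)//= eq_sym.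
have -> : (\sum_(i < d) excess a (tnth s i) =
    excess a (tnth s i) + (excess a (tnth s j) +
      \sum_(k < d | (k != i) && (k != j)) excess a (tnth s k)))%R.
  by rewrite (bigD1 i)//= (bigD1 j)//= eq_sym.
have -> : (excess a (tnth s i) = tnth s i - a)%R by rewrite /excess max_l// subr_ge0.
have -> : (excess a (tnth s j) = tnth s j - a)%R by rewrite /excess max_l// subr_ge0.
have : (\sum_(k < d | (k != i) && (k != j)) excess a (tnth s k) <=
        \sum_(k < d | (k != i) && (k != j)) tnth s k)%R.
  by apply: ler_sum => k _; exact: excess_le.
lra.
Qed.

(** * Measurability and sigma-finiteness *)

Section measurability.
Context (R : realType) (d : nat).

Lemma measurable_tsum : measurable_fun setT (@tsum R d).
Proof. by apply: measurable_sum => i; exact: measurable_tnth. Qed.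

Lemma measurable_sqnorm : measurable_fun setT (@sqnorm R d).
Proof. by apply: measurable_sum => i; apply: measurable_funX; exact: measurable_tnth. Qed.

Lemma measurable_fst_part : measurable_fun setT (@fst_part R d).
Proof.
apply/measurable_fun_tnthP => i.
rewrite (_ : _ \o _ = fun z => tnth z (lshift d i)); first exact: measurable_tnth.
by apply/funext => s /=; rewrite tnth_mktuple.
Qed.

Lemma measurable_snd_part : measurable_fun setT (@snd_part R d).
Proof.
apply/measurable_fun_tnthP => i.
rewrite (_ : _ \o _ = fun z => tnth z (rshift d i)); first exact: measurable_tnth.
by apply/funext => s /=; rewrite tnth_mktuple.
Qed.

Lemma measurable_pred d' (X : measurableType d') (f : X -> bool) :
  measurable_fun setT f -> measurable [set x | f x].
Proof.
move=> mf; have : measurable (f @^-1` [set true]) by rewrite -[X in measurable X]setTI; exact: mf.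
by congr (measurable _); apply/seteqP; split.
Qed.

Lemma measurable_Omega : measurable (Omega d : set (d.-tuple R)).
Proof.
rewrite (_ : Omega d = (\bigcap_(i in [set: 'I_d]) [set s | 0 <= tnth s i]%R) `&`
   (\bigcup_(i in [set: 'I_d]) [set s : d.-tuple R | tnth s i != 0%R])).
  apply: measurableI.
    apply: fin_bigcap_measurable => // i _; apply: measurable_pred.
    by apply: measurable_fun_ler => //; exact: measurable_tnth.
  apply: fin_bigcup_measurable => // i _; apply: measurable_pred.
  rewrite (_ : (fun _ => _) = (fun s : d.-tuple R => ~~ (tnth s i == 0%R))) //.
  apply: measurable_neg; apply: measurable_fun_eqr => //; exact: measurable_tnth.
apply/seteqP; split => [s [s0 [i si]]|s [s0 [i _ si]]].
  by split => [j _|]; [exact: s0|exists i].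
by split => [j|]; [exact: s0|exists i].
Qed.

End measurability.

Lemma sqnorm_ge0 (R : realType) d (s : d.-tuple R) : (0 <= sqnorm s)%R.
Proof. by apply: sumr_ge0 => i _; exact: sqr_ge0. Qed.

Lemma sqnorm_gt0 (R : realType) d (s : d.-tuple R) : Omega d s -> (0 < sqnorm s)%R.
Proof.
move=> [_ [i si]]; rewrite /sqnorm (bigD1 i)//= ltr_pwDl ?exprn_even_gt0//.
by apply: sumr_ge0 => j _; exact: sqr_ge0.
Qed.

Lemma notin_Omega (R : realType) d (s : d.-tuple R) :
  (forall i, 0 <= tnth s i)%R -> ~ Omega d s -> forall i, tnth s i = 0%R.
Proof.
move=> s0 sO i; apply/eqP/negP => /negP si; apply: sO; split => //; by exists i.
Qed.

(** By Chebyshev the sets where [sqnorm] is at least 1/(n+1) have finite mass, and they exhaust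
    [Omega d]; the null complement is added to each of them. This makes Tonelli available for
    couplings. *)
Lemma inM2_sigma_finite (R : realType) d (g : {measure set (d.-tuple R) -> \bar R}) :
  inM2 g -> sigma_finite setT g.
Proof.
move=> [gO gfin].
pose F n : set (d.-tuple R) := (~` Omega d) `|`
  (Omega d `&` [set s | n.+1%:R^-1%:E <= `|(sqnorm s)%:E|]).
have mF n : measurable (Omega d `&` [set s : d.-tuple R | n.+1%:R^-1%:E <= `|(sqnorm s)%:E|]).
  apply: emeasurable_fun_c_infty; first exact: measurable_Omega.
  apply: measurableT_comp => //; apply/measurable_EFinP/measurable_funTS; exact: measurable_sqnorm.
exists F => [|n].
  apply/esym; rewrite -subTset => s _.
  have [sO|sO] := pselect (Omega d s); last by exists 0%N => //; left.
  have s0 := sqnorm_gt0 sO.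
  exists (Num.truncn (sqnorm s)^-1) => //; right; split => //=.
  rewrite lee_fin ger0_norm ?sqnorm_ge0// invf_ple ?posrE ?ltr0n//.
  exact/ltW/truncnS_gt.
have mC : measurable (~` Omega d : set (d.-tuple R)).
  by apply: measurableC; exact: measurable_Omega.
split; first exact: measurableU.
apply: (@le_lt_trans _ _ (g (~` Omega d) +
    g (Omega d `&` [set s | n.+1%:R^-1%:E <= `|(sqnorm s)%:E|]))).
  exact: measureU2.
rewrite gO add0e.
have : n.+1%:R^-1%:E * g (Omega d `&` [set s | n.+1%:R^-1%:E <= `|(sqnorm s)%:E|]) < +oo.
  apply: le_lt_trans (gfin).
  have n0 : (0 < n.+1%:R^-1 :> R)%R by rewrite invr_gt0 ltr0n.
  have mq : measurable_fun (Omega d) (fun s : d.-tuple R => (sqnorm s)%:E).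
    by apply/measurable_EFinP/measurable_funTS; exact: measurable_sqnorm.
  apply: (le_trans (le_integral_abse g (@measurable_Omega R d) mq n0)).
  by under eq_integral do rewrite gee0_abs ?lee_fin ?sqnorm_ge0//.
by rewrite lte_pdivrMl// gt0_muley// lte_fin.
Qed.

(** * Couplings with nu_co *)

(** In a coupling with [nu_co] the second component is almost surely a constant vector (t, ..., t);
    t is read off at the fixed coordinate [i0]. *)
Definition height (R : realType) d (i0 : 'I_d) (z : (d + d).-tuple R) : R :=
  tnth (snd_part z) i0.

Lemma measurable_bool_natr (R : realType) d' (X : measurableType d') (f : X -> bool) :
  measurable_fun setT f -> measurable_fun setT (fun x => (f x)%:R : R).
Proof.
move=> mf; rewrite (_ : (fun _ => _) = \1_[set x | f x]).
  by apply: measurable_indic; exact: measurable_pred.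
by apply/funext => x; rewrite indicE (_ : (x \in _) = f x)//; apply/idP/idP; rewrite inE.
Qed.

Section couplings_with_nu_co.
Context (R : realType) (d : nat) (i0 : 'I_d) (nubar : {measure set R -> \bar R}).

Lemma measurable_height : measurable_fun setT (@height R d i0).
Proof.
exact: (measurableT_comp (measurable_tnth i0) (@measurable_snd_part R d)).
Qed.

Lemma fst_part_ge0 (z : (d + d).-tuple R) : Omega (d + d) z ->
  forall i, (0 <= tnth (fst_part z) i)%R.
Proof. by move=> [z0 _] i; rewrite tnth_mktuple. Qed.

Lemma snd_part_ge0 (z : (d + d).-tuple R) : Omega (d + d) z ->
  forall i, (0 <= tnth (snd_part z) i)%R.
Proof. by move=> [z0 _] i; rewrite tnth_mktuple. Qed.

Lemma tsum_ge0 (s : d.-tuple R) : (forall i, 0 <= tnth s i)%R -> (0 <= tsum s)%R.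
Proof. by move=> s0; exact: sumr_ge0. Qed.

Lemma measurable_Omega1 : measurable (Omega1 : set R).
Proof.
rewrite (_ : Omega1 = `]0%R, +oo[%classic); first exact: measurable_itv.
by apply/seteqP; split => x; rewrite /Omega1/= in_itv/= andbT.
Qed.

Lemma integral_fst_part (nu1 nu2 : {measure set (d.-tuple R) -> \bar R})
    (g : {measure set ((d + d).-tuple R) -> \bar R}) (f : d.-tuple R -> \bar R) :
  couplings nu1 nu2 g -> measurable_fun setT f ->
  (forall s, Omega d s -> 0 <= f s) ->
  (forall s, (forall i, tnth s i = 0%R) -> f s = 0) ->
  \int[g]_(z in Omega (d + d)) f (fst_part z) = \int[nu1]_(s in Omega d) f s.
Proof.
move=> [[gO _] g1 _] mf f0 fz; apply: ge0_integral_marginal => //.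
- exact: measurable_fst_part.
- exact: measurable_Omega.
- exact: measurable_Omega.
- move=> z zO zN; apply: fz; apply: notin_Omega => //; exact: fst_part_ge0.
Qed.

Lemma integral_snd_part (nu1 nu2 : {measure set (d.-tuple R) -> \bar R})
    (g : {measure set ((d + d).-tuple R) -> \bar R}) (f : d.-tuple R -> \bar R) :
  couplings nu1 nu2 g -> measurable_fun setT f ->
  (forall s, Omega d s -> 0 <= f s) ->
  (forall s, (forall i, tnth s i = 0%R) -> f s = 0) ->
  \int[g]_(z in Omega (d + d)) f (snd_part z) = \int[nu2]_(s in Omega d) f s.
Proof.
move=> [[gO _] _ g2] mf f0 fz; apply: ge0_integral_marginal => //.
- exact: measurable_snd_part.
- exact: measurable_Omega.
- exact: measurable_Omega.
- move=> z zO zN; apply: fz; apply: notin_Omega => //; exact: snd_part_ge0.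
Qed.

Lemma Omega_diag (x : R) : Omega d (diag d x) <-> (0 < x)%R.
Proof.
split=> [[x0 [i]]|x0].
  rewrite tnth_mktuple => xn0; rewrite lt_neqAle eq_sym xn0/=.
  by have := x0 i; rewrite tnth_mktuple.
split => [i|]; first by rewrite tnth_mktuple ltW.
by exists i0; rewrite tnth_mktuple gt_eqF.
Qed.

Lemma integral_nu_co (f : d.-tuple R -> \bar R) : nubar (~` Omega1) = 0 ->
  measurable_fun setT f -> (forall s, Omega d s -> 0 <= f s) ->
  \int[nu_co d nubar]_(s in Omega d) f s = \int[nubar]_(x in Omega1) f (diag d x).
Proof.
move=> nub0 mf f0; apply/esym; apply: ge0_integral_marginal => //.
- exact: measurable_diag.
- exact: measurable_Omega1.
- exact: measurable_Omega.
- by move=> x /Omega_diag.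
Qed.

Lemma integral_marginal (nu : {measure set (d.-tuple R) -> \bar R}) (i : 'I_d)
    (f : R -> \bar R) : nu (~` Omega d) = 0 -> has_marginals nu nubar ->
  measurable_fun setT f -> (forall x, (0 < x)%R -> 0 <= f x) -> f 0%R = 0 ->
  \int[nu]_(s in Omega d) f (tnth s i) = \int[nubar]_(x in Omega1) f x.
Proof.
move=> nu0 hm mf f0 fz; apply: (ge0_integral_marginal (g := fun s => tnth s i)) => //.
- exact: measurable_tnth.
- exact: measurable_Omega.
- exact: measurable_Omega1.
- by move=> A mA A1; exact: hm.
- move=> s [s0 _] /negP; rewrite -leNgt => si.
  by rewrite (_ : tnth s i = 0%R)//; apply/eqP; rewrite eq_le si s0.
Qed.

Lemma integral_sum_marginals (nu : {measure set (d.-tuple R) -> \bar R})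
    (f : R -> R) : nu (~` Omega d) = 0 -> has_marginals nu nubar ->
  measurable_fun setT f -> (forall x, 0 <= f x)%R -> f 0%R = 0%R ->
  \int[nu]_(s in Omega d) (\sum_(i < d) f (tnth s i))%R%:E =
  \sum_(i < d) \int[nubar]_(x in Omega1) (f x)%:E.
Proof.
move=> nu0 hm mf f0 fz.
under eq_integral do rewrite -sumEFin.
rewrite ge0_integral_sum//; last 3 first.
- exact: measurable_Omega.
- move=> i; apply/measurable_EFinP/measurable_funTS; apply: (measurableT_comp mf); exact: measurable_tnth.
- by move=> i s _; rewrite lee_fin.
apply: eq_bigr => i _.
rewrite (@integral_marginal nu i (fun x => (f x)%:E))//.
- exact/measurable_EFinP.
- by move=> x _; rewrite lee_fin.
- by rewrite fz.
Qed.

Lemma integral_sqnorm (nu : {measure set (d.-tuple R) -> \bar R}) :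
  nu (~` Omega d) = 0 -> has_marginals nu nubar ->
  \int[nu]_(s in Omega d) (sqnorm s)%:E =
  \sum_(i < d) \int[nubar]_(x in Omega1) (x ^+ 2)%:E.
Proof.
move=> nu0 hm; rewrite (@integral_sum_marginals nu (fun x => (x ^+ 2)%R))//.
- by move=> x; rewrite sqr_ge0.
- by rewrite expr0n.
Qed.

Lemma nu_co_setCOmega : nubar (~` Omega1) = 0 -> nu_co d nubar (~` Omega d) = 0.
Proof.
move=> <-; rewrite /nu_co /pushforward; congr (nubar _).
by apply/seteqP; split => x /= h xx; apply: h; exact/Omega_diag.
Qed.

Lemma nu_co_has_marginals : has_marginals (nu_co d nubar) nubar.
Proof.
move=> i A mA A1; rewrite /nu_co /pushforward; congr (nubar _).
by apply/seteqP; split => x /=; rewrite tnth_mktuple.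
Qed.

(** The non-constant vectors of [Omega d] have empty preimage under [diag], hence are null for
    [nu_co]. A second component outside [Omega d] is the origin, which is constant too. *)
Lemma coupling_height_diag (nu : {measure set (d.-tuple R) -> \bar R})
    (g : {measure set ((d + d).-tuple R) -> \bar R}) :
  couplings nu (nu_co d nubar) g ->
  {ae g, forall z, Omega (d + d) z -> forall i, tnth (snd_part z) i = height i0 z}.
Proof.
move=> [_ _ g2].
pose W : set (d.-tuple R) := Omega d `&`
  \bigcup_(i in [set: 'I_d]) [set s | tnth s i != tnth s i0].
have mW : measurable W.
  apply: measurableI; first exact: measurable_Omega.
  apply: fin_bigcup_measurable => // i _; apply: measurable_pred.
  rewrite (_ : (fun _ => _) = (fun s : d.-tuple R => ~~ (tnth s i == tnth s i0))) //.
  by apply: measurable_neg; apply: measurable_fun_eqr => //; exact: measurable_tnth.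
exists (@snd_part R d @^-1` W); split.
- by rewrite -[X in measurable X]setTI; exact: measurable_snd_part.
- have := g2 W mW (@subIsetl _ _ _); rewrite {1}/pushforward => ->.
  rewrite -(measure0 nubar) /= /nu_co /pushforward; congr (nubar _).
  by apply/seteqP; split => // x [_ [i _ /=]]; rewrite !tnth_mktuple eqxx.
- move=> z /= /not_implyP[zO] /existsNP[i /eqP zi]; split; last by exists i.
  have [//|sN] := pselect (Omega d (snd_part z)).
  have s0 := notin_Omega (snd_part_ge0 zO) sN.
  by move: zi; rewrite /height !s0 eqxx.
Qed.

(** For t = (t, ..., t) one has |s - t|^2 + 2 S t = |s|^2 + |t|^2. The cross term stays on the left,
    so that only nonnegative quantities are added and no difference of infinities can arise. *)
Lemma cost_identity (nu : {measure set (d.-tuple R) -> \bar R})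
    (g : {measure set ((d + d).-tuple R) -> \bar R}) :
  couplings nu (nu_co d nubar) g ->
  \int[g]_(z in Omega (d + d)) (sqnorm (tsub (fst_part z) (snd_part z)))%:E +
  2%:E * \int[g]_(z in Omega (d + d)) (tsum (fst_part z) * height i0 z)%:E =
  \int[nu]_(s in Omega d) (sqnorm s)%:E +
  \int[nu_co d nubar]_(s in Omega d) (sqnorm s)%:E.
Proof.
move=> hg; have mO := @measurable_Omega R (d + d).
have mq : measurable_fun setT (fun s : d.-tuple R => (sqnorm s)%:E).
  by apply/measurable_EFinP; exact: measurable_sqnorm.
have q0 (s : d.-tuple R) : 0 <= (sqnorm s)%:E by rewrite lee_fin sqnorm_ge0.
have qz (s : d.-tuple R) : (forall i, tnth s i = 0%R) -> (sqnorm s)%:E = 0.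
  by move=> s0; rewrite /sqnorm big1// => i _; rewrite s0 expr0n.
rewrite -(integral_fst_part hg)// -(integral_snd_part hg)//.
have mf : measurable_fun setT (fun z : (d + d).-tuple R => (sqnorm (fst_part z))%:E).
  by apply: (measurableT_comp mq); exact: measurable_fst_part.
have ms : measurable_fun setT (fun z : (d + d).-tuple R => (sqnorm (snd_part z))%:E).
  by apply: (measurableT_comp mq); exact: measurable_snd_part.
have mt : measurable_fun setT (fun z : (d + d).-tuple R => (sqnorm (tsub (fst_part z) (snd_part z)))%:E).
  apply/measurable_EFinP; apply: measurable_sum => i; apply: measurable_funX.
  rewrite (_ : (fun _ => _) = fun z => (tnth (fst_part z) i - tnth (snd_part z) i)%R); last first.
    by apply/funext => z; rewrite tnth_mktuple.
  apply: measurable_funB.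
    exact: (measurableT_comp (measurable_tnth i) (@measurable_fst_part R d)).
  exact: (measurableT_comp (measurable_tnth i) (@measurable_snd_part R d)).
have mp : measurable_fun setT (fun z : (d + d).-tuple R => (tsum (fst_part z) * height i0 z)%:E).
  apply/measurable_EFinP; apply: measurable_funM; last exact: measurable_height.
  exact: (measurableT_comp (@measurable_tsum R d) (@measurable_fst_part R d)).
have p0 (z : (d + d).-tuple R) : Omega (d + d) z -> 0 <= (tsum (fst_part z) * height i0 z)%:E.
  move=> zO; rewrite lee_fin; apply: mulr_ge0; last exact: (snd_part_ge0 zO i0).
  by apply: tsum_ge0; exact: fst_part_ge0.
rewrite -ge0_integralZl; [|exact: mO|exact: measurable_funTS|exact: p0|by []].
rewrite -!ge0_integralD//; try exact: measurable_funTS; last 2 first.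
- by move=> z /p0 h; rewrite mule_ge0// lee_fin.
- by apply: measurable_funTS; exact: measurable_funeM.
apply: ge0_ae_eq_integral => //.
- by apply: measurable_funTS; apply: emeasurable_funD => //; exact: measurable_funeM.
- by apply: measurable_funTS; apply: emeasurable_funD.
- by move=> z /p0 h; rewrite adde_ge0// mule_ge0// lee_fin.
- by move=> z _; rewrite adde_ge0.
have := coupling_height_diag hg; apply: filterS => z zd zO.
rewrite -EFinM -!EFinD; congr (_%:E).
rewrite /sqnorm /tsum mulr_suml mulr_sumr -!big_split/=; apply: eq_bigr => i _.
rewrite tnth_mktuple -(zd zO i); lra.
Qed.

(** As [y] is positive, the indicator vanishes at the origin, so the mass that the second projection
    may put there is not counted. *)
Lemma height_tail (nu : {measure set (d.-tuple R) -> \bar R})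
    (g : {measure set ((d + d).-tuple R) -> \bar R}) (y : R) :
  nubar (~` Omega1) = 0 ->
  couplings nu (nu_co d nubar) g -> (0 < y)%R ->
  \int[g]_(z in Omega (d + d)) (y < height i0 z)%R%:R%:E = nubar `]y, +oo[%classic.
Proof.
move=> nub0 hg y0.
have mf : measurable_fun setT (fun s : d.-tuple R => (y < tnth s i0)%R%:R%:E : \bar R).
  apply/measurable_EFinP; apply: measurable_bool_natr.
  by apply: measurable_fun_ltr => //; exact: measurable_tnth.
have f0 (s : d.-tuple R) : Omega d s -> 0 <= ((y < tnth s i0)%R%:R%:E : \bar R).
  by move=> _; rewrite lee_fin ler0n.
rewrite (integral_snd_part hg mf f0); last by move=> s ->; rewrite ltNge ltW.
rewrite (integral_nu_co nub0 mf f0).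
under eq_integral do rewrite tnth_mktuple.
rewrite (_ : (fun x => _) = fun x => (\1_(`]y, +oo[%classic : set R) x)%:E); last first.
  by apply/funext => x; rewrite indicE mem_setE in_itv/= andbT.
rewrite integral_indic//; last exact: measurable_Omega1.
congr (nubar _); apply/setIidl => x /=; rewrite in_itv/= andbT /Omega1/=.
exact: lt_trans.
Qed.

Lemma measurable_fst_excess (a : R) : measurable_fun setT
  (fun z : (d + d).-tuple R => excess a (tsum (fst_part z))).
Proof.
apply: (measurableT_comp (measurable_excess a)).
exact: (measurableT_comp (@measurable_tsum R d) (@measurable_fst_part R d)).
Qed.

Lemma measurable_height_ind (y : R) : measurable_fun setT
  (fun z : (d + d).-tuple R => (y < height i0 z)%R%:R : R).
Proof.
apply: measurable_bool_natr.
by apply: measurable_fun_ltr => //; exact: measurable_height.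
Qed.

Lemma measurable_level (y : R) : measurable_fun setT
  (fun z : (d + d).-tuple R => if (y < height i0 z)%R then tsum (fst_part z) else 0%R).
Proof.
apply: measurable_fun_ifT => //.
  by apply: measurable_fun_ltr => //; exact: measurable_height.
exact: (measurableT_comp (@measurable_tsum R d) (@measurable_fst_part R d)).
Qed.

(** The integrand is the pointwise upper bound of S 1_{t > y}; [level_le] and [level_ge] both
    compare the level integral with it. *)
Lemma integral_threshold (nu : {measure set (d.-tuple R) -> \bar R})
    (g : {measure set ((d + d).-tuple R) -> \bar R}) (y a : R) :
  nubar (~` Omega1) = 0 ->
  couplings nu (nu_co d nubar) g -> (0 < y)%R -> (0 <= a)%R ->
  \int[g]_(z in Omega (d + d)) (a * (y < height i0 z)%R%:R + excess a (tsum (fst_part z)))%:E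
  = a%:E * nubar `]y, +oo[%classic + \int[nu]_(s in Omega d) (excess a (tsum s))%:E.
Proof.
move=> nub0 hg y0 a0; have mO := @measurable_Omega R (d + d).
have mi : measurable_fun (Omega (d + d))
    (fun z : (d + d).-tuple R => (y < height i0 z)%R%:R%:E : \bar R).
  by apply: measurable_funTS; apply/measurable_EFinP; exact: measurable_height_ind.
have me : measurable_fun (Omega (d + d))
    (fun z : (d + d).-tuple R => (excess a (tsum (fst_part z)))%:E).
  by apply: measurable_funTS; apply/measurable_EFinP; exact: measurable_fst_excess.
under eq_integral do rewrite EFinD EFinM.
rewrite ge0_integralD; [|exact: mO| | |by move=> z _; rewrite lee_fin excess_ge0|exact: me]; last 2 first.
- by move=> z _; rewrite mule_ge0// lee_fin ler0n.
- exact: measurable_funeM.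
rewrite ge0_integralZl; [|exact: mO|exact: mi|by move=> z _; rewrite lee_fin ler0n|by rewrite lee_fin].
rewrite (height_tail nub0 hg)// (integral_fst_part (f := fun s => (excess a (tsum s))%:E) hg)//.
- apply/measurable_EFinP; exact: (measurableT_comp (measurable_excess a) (@measurable_tsum R d)).
- by move=> s _; rewrite lee_fin excess_ge0.
- by move=> s s0; rewrite /tsum big1// /excess sub0r max_r// oppr_le0.
Qed.

Lemma level_le (nu : {measure set (d.-tuple R) -> \bar R})
    (g : {measure set ((d + d).-tuple R) -> \bar R}) (y a : R) :
  nubar (~` Omega1) = 0 ->
  couplings nu (nu_co d nubar) g -> (0 < y)%R -> (0 <= a)%R ->
  \int[g]_(z in Omega (d + d)) (if (y < height i0 z)%R then tsum (fst_part z) else 0%R)%:E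
  <= a%:E * nubar `]y, +oo[%classic + \int[nu]_(s in Omega d) (excess a (tsum s))%:E.
Proof.
move=> nub0 hg y0 a0; rewrite -(integral_threshold nub0 hg y0 a0).
apply: ge0_le_integral => //.
- exact: measurable_Omega.
- move=> z zO; rewrite lee_fin; case: ifP => // _; apply: tsum_ge0; exact: fst_part_ge0.
- by apply: measurable_funTS; apply/measurable_EFinP; exact: measurable_level.
- apply: measurable_funTS; apply/measurable_EFinP.
  apply: measurable_funD; last exact: measurable_fst_excess.
  by apply: measurable_funM => //; exact: measurable_height_ind.
- move=> z zO; rewrite lee_fin; case: ifP => _; rewrite ?mulr1 ?mulr0 ?add0r ?excess_ge0//.
  by rewrite -lerBlDl le_excess.
Qed.

(** The sandwich is the equality case of the pointwise bound: if t > y then S >= a and a + (S - a)_+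
    = S; otherwise S <= a and the bound is 0. *)
Lemma level_ge (nu : {measure set (d.-tuple R) -> \bar R})
    (g : {measure set ((d + d).-tuple R) -> \bar R}) (y a : R) :
  nubar (~` Omega1) = 0 ->
  couplings nu (nu_co d nubar) g -> (0 < y)%R -> (0 <= a)%R ->
  {ae g, forall z, Omega (d + d) z ->
    ((a < tsum (fst_part z))%R -> (y < height i0 z)%R) /\
    ((y < height i0 z)%R -> (a <= tsum (fst_part z))%R)} ->
  a%:E * nubar `]y, +oo[%classic + \int[nu]_(s in Omega d) (excess a (tsum s))%:E <=
  \int[g]_(z in Omega (d + d)) (if (y < height i0 z)%R then tsum (fst_part z) else 0%R)%:E.
Proof.
move=> nub0 hg y0 a0 ha; rewrite -(integral_threshold nub0 hg y0 a0).
apply: ae_ge0_le_integral => //.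
- exact: measurable_Omega.
- by move=> z zO; rewrite lee_fin addr_ge0 ?excess_ge0// mulr_ge0.
- apply: measurable_funTS; apply/measurable_EFinP.
  apply: measurable_funD; last exact: measurable_fst_excess.
  by apply: measurable_funM => //; exact: measurable_height_ind.
- move=> z zO; rewrite lee_fin; case: ifP => // _; apply: tsum_ge0; exact: fst_part_ge0.
- by apply: measurable_funTS; apply/measurable_EFinP; exact: measurable_level.
move: ha; apply: filterS => z hz zO; have [h1 h2] := hz zO.
rewrite lee_fin; case: ifP => yz; rewrite ?mulr1 ?mulr0 ?add0r.
  by rewrite /excess max_l ?subr_ge0 ?h2// addrC subrK.
by rewrite /excess max_r// subr_le0 leNgt; apply/negP => /h1; rewrite yz.
Qed.

Lemma coupling_layer_cake (nu1 nu2 : {measure set (d.-tuple R) -> \bar R})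
    (g : {measure set ((d + d).-tuple R) -> \bar R}) :
  couplings nu1 nu2 g ->
  \int[g]_(z in Omega (d + d)) (tsum (fst_part z) * height i0 z)%:E =
  \int[lebesgue_measure]_(y in `]0%R, +oo[)
  \int[g]_(z in Omega (d + d)) (if (y < height i0 z)%R then tsum (fst_part z) else 0%R)%:E.
Proof.
move=> [g2 _ _]; have sf := inM2_sigma_finite g2.
(* The second moment bound turns [g] into a sigma-finite measure, as Tonelli requires. *)
pose H1 := isSFinite.Build _ _ _ (g : set _ -> _) (sfinite_measure_sigma_finite sf).
pose H2 := isSigmaFinite.Build _ _ _ (g : set _ -> _) sf.
pose g' := HB.pack_for (SigmaFiniteMeasure.type ((d + d).-tuple R) R) (Measure.sort g) H1 H2.
apply: (@ge0_integral_layer_cake _ _ _ g').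
- exact: measurable_Omega.
- exact: (measurableT_comp (@measurable_tsum R d) (@measurable_fst_part R d)).
- exact: measurable_height.
- by move=> z zO; apply: tsum_ge0; exact: fst_part_ge0.
- by move=> z zO; exact: (snd_part_ge0 zO i0).
Qed.

Lemma measurable_level_integral (nu1 nu2 : {measure set (d.-tuple R) -> \bar R})
    (g : {measure set ((d + d).-tuple R) -> \bar R}) :
  couplings nu1 nu2 g -> measurable_fun [set: R] (fun y =>
  \int[g]_(z in Omega (d + d)) (if (y < height i0 z)%R then tsum (fst_part z) else 0%R)%:E).
Proof.
move=> [g2 _ _]; have sf := inM2_sigma_finite g2.
pose H1 := isSFinite.Build _ _ _ (g : set _ -> _) (sfinite_measure_sigma_finite sf).
pose H2 := isSigmaFinite.Build _ _ _ (g : set _ -> _) sf.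
pose g' := HB.pack_for (SigmaFiniteMeasure.type ((d + d).-tuple R) R) (Measure.sort g) H1 H2.
apply: (@measurable_layer _ _ _ g').
- exact: measurable_Omega.
- exact: (measurableT_comp (@measurable_tsum R d) (@measurable_fst_part R d)).
- exact: measurable_height.
- by move=> z zO; apply: tsum_ge0; exact: fst_part_ge0.
Qed.

End couplings_with_nu_co.

(** * The quantile coupling *)

Section quantile_coupling.
Context (R : realType) (dX : measure_display) (X : measurableType dX).
Variables (mu : {measure set X -> \bar R}) (D : set X) (h : X -> R).
Hypotheses (mD : measurable D) (mh : measurable_fun setT h).
Hypotheses (h_gt0 : forall x, D x -> (0 < h x)%R).

(** Closed tail, open tail and atoms of the law of [h] on [D]. The total mass may be infinite, so
    quantiles are counted from the top, where tails are finite. *)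
Let V (x : R) : \bar R := mu (D `&` [set t | (x <= h t)%R]).
Let U (x : R) : \bar R := mu (D `&` [set t | (x < h t)%R]).
Let p (x : R) : \bar R := mu (D `&` [set t | h t == x]).

Hypotheses (V_fin : forall x, (0 < x)%R -> V x < +oo).
Hypotheses (V_small : forall c : R, (0 < c)%R -> exists2 x : R, (0 < x)%R & V x < c%:E).

Let mV x : measurable (D `&` [set t | (x <= h t)%R]).
Proof. by apply: measurableI => //; apply: measurable_pred; exact: measurable_fun_ler. Qed.

Let mU x : measurable (D `&` [set t | (x < h t)%R]).
Proof. by apply: measurableI => //; apply: measurable_pred; exact: measurable_fun_ltr. Qed.

Let mp x : measurable (D `&` [set t | h t == x]).
Proof. by apply: measurableI => //; apply: measurable_pred; exact: measurable_fun_eqr. Qed.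

Let VE x : V x = U x + p x.
Proof.
rewrite /V /U /p -measureU//; last first.
  by apply/seteqP; split => // t [[_ /= xh] [_ /= /eqP hx]]; move: xh; rewrite hx ltxx.
congr (mu _); rewrite -setIUr; congr (_ `&` _).
apply/seteqP; split => t /=; rewrite le_eqVlt (eq_sym x); first by move/orP; tauto.
by move=> [->|->]; rewrite ?orbT.
Qed.

Let V_le x y : (x <= y)%R -> V y <= V x.
Proof.
move=> xy; apply: le_measure; rewrite ?inE//.
by move=> t [Dt /= yt]; split => //=; exact: le_trans yt.
Qed.

Let V_le_U x y : (x < y)%R -> V y <= U x.
Proof.
move=> xy; apply: le_measure; rewrite ?inE//.
by move=> t [Dt /= yt]; split => //=; exact: lt_le_trans yt.
Qed.

(** The threshold is the generalised inverse of the tail at [c], the supremum of the levels whose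
    closed tail is at least [c]. Continuity from below bounds the open tail at [a], continuity from
    above the closed one. *)
Lemma threshold_exists (c : R) : (0 < c)%R -> c%:E <= mu D ->
  exists2 a : R, (0 <= a)%R &
  [/\ forall x, (a < x)%R -> V x < c%:E,
      forall x, (0 <= x)%R -> (x < a)%R -> c%:E <= V x,
      U a <= c%:E & c%:E <= V a].
Proof.
move=> c0 cD.
have V0 : V 0%R = mu D.
  congr (mu _); apply/seteqP; split => [t []//|t Dt]; split => //=.
  exact/ltW/h_gt0.
pose A : set R := [set x | (0 <= x)%R /\ c%:E <= V x].
have A0 : A 0%R by split => //; rewrite V0.
have [b b0 Vb] := V_small c0.
have Ab x : A x -> (x <= b)%R.
  move=> [x0 cx]; rewrite leNgt; apply/negP => bx.
  by have := lt_le_trans Vb cx; rewrite ltNge V_le// ltW.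
have hA : has_sup A by split; [exists 0%R|exists b => x /Ab].
have a0 : (0 <= sup A)%R by apply: (sup_upper_bound hA).
have gtA x : (sup A < x)%R -> V x < c%:E.
  move=> ax; rewrite ltNge; apply/negP => cx.
  have : A x by split => //; apply: le_trans a0 _; exact: ltW.
  by move/(sup_upper_bound hA); rewrite leNgt ax.
have ltA x : (0 <= x)%R -> (x < sup A)%R -> c%:E <= V x.
  move=> x0 /sup_gt[|y [_ cy] xy]; first by exists 0%R.
  by apply: (le_trans cy); apply: V_le; exact: ltW.
exists (sup A) => //; split => //.
- have cov : D `&` [set t | (sup A < h t)%R] =
      \bigcup_n (D `&` [set t | (sup A + n.+1%:R^-1 <= h t)%R]).
    apply/seteqP; split => [t [Dt /= at_]|t [n _ [Dt /= at_]]]; last first.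
      by split => //=; apply: lt_le_trans at_; rewrite ltrDl invr_gt0 ltr0n.
    exists (Num.truncn (h t - sup A)^-1) => //; split => //=.
    rewrite -lerBrDl invf_ple ?posrE ?ltr0n ?subr_gt0//.
    exact/ltW/truncnS_gt.
  have mc : measurable (\bigcup_n (D `&` [set t | (sup A + n.+1%:R^-1 <= h t)%R])).
    by rewrite -cov.
  have nd : nondecreasing_seq (fun n => D `&` [set t | (sup A + n.+1%:R^-1 <= h t)%R]).
    move=> i j ij; apply/subsetPset => t [Dt /= it]; split => //=.
    apply: le_trans it; rewrite lerD2l lef_pV2 ?posrE ?ltr0n// ler_nat ltnS.
    exact: ij.
  rewrite /U cov; apply: (cvge_to_le (nondecreasing_cvg_mu _ mc nd)); first by move=> n; exact: mV.
  apply: nearW => n; apply/ltW/gtA; by rewrite ltrDl invr_gt0 ltr0n.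
(* At threshold 0 the tail is [mu D], possibly infinite, so continuity from above is replaced by the
   assumption c <= mu D. *)
- have := a0; rewrite le_eqVlt => /predU1P[<-|a_gt0]; first by rewrite V0.
  have cov : D `&` [set t | (sup A <= h t)%R] =
      (* The denominator n+2 keeps every level strictly positive, so that already the first tail is
         finite. *)
      \bigcap_n (D `&` [set t | (sup A - sup A / n.+2%:R <= h t)%R]).
    apply/seteqP; split => [t [Dt /= at_] n _|t H].
      by split => //=; apply: le_trans at_; rewrite gerBl divr_ge0.
    have [Dt _] := H 0%N I; split => //=; rewrite leNgt; apply/negP => ta.
    have e0 : (0 < (sup A)^-1 * (sup A - h t))%R by rewrite mulr_gt0 ?subr_gt0 ?invr_gt0.
    have [_ /=] := H (Num.truncn ((sup A)^-1 * (sup A - h t))^-1) I.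
    apply/negP; rewrite -ltNge ltrBrDr -ltrBrDl -ltr_pdivlMl//.
    rewrite invf_plt ?posrE ?ltr0n//.
    by apply: lt_trans (truncnS_gt _) _; rewrite ltr_nat.
  have mc : measurable (\bigcap_n (D `&` [set t | (sup A - sup A / n.+2%:R <= h t)%R])).
    by rewrite -cov.
  have nd : nonincreasing_seq (fun n => D `&` [set t | (sup A - sup A / n.+2%:R <= h t)%R]).
    move=> i j ij; apply/subsetPset => t [Dt /= it]; split => //=.
    apply: le_trans it; rewrite lerD2l lerN2 ler_pM2l//.
    rewrite lef_pV2 ?posrE ?ltr0n// ler_nat !ltnS; exact: ij.
  have pos n : (0 < sup A - sup A / n.+2%:R)%R.
    by rewrite subr_gt0 ltr_pdivrMr ?ltr0n// ltr_pMr// ltr1n.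
  rewrite /V cov; apply: (cvge_to_ge (nonincreasing_cvg_mu _ _ mc nd)).
  + exact: V_fin.
  + by move=> n; exact: mV.
  + apply: nearW => n; apply: ltA; first exact: ltW.
    by rewrite gtrBl divr_gt0// ltr0n.
Qed.

Let P := uniform_prob (@ltr01 R).

Lemma uniform_prob01_lt (r : R) : (0 <= r)%R -> (r <= 1)%R ->
  P [set v | (0 <= v <= 1)%R && (v < r)%R] = r%:E.
Proof.
move=> r0 r1; rewrite /P /uniform_prob integral_uniform_pdf.
rewrite (_ : _ `&` _ = `[0%R, r[%classic); last first.
  apply/seteqP; split => v /=; rewrite !in_itv/=.
    by move=> [/andP[/andP[-> _] ->]].
  move=> /andP[v0 vr]; rewrite v0 vr (ltW (lt_le_trans vr r1)); split => //.
rewrite (eq_integral (fun=> 1%:E)); last first.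
  move=> v; rewrite inE/= in_itv/= => /andP[v0 vr].
  by rewrite /uniform_pdf v0 (ltW (lt_le_trans vr r1)) subr0 invr1.
rewrite integral_cst//= mul1e lebesgue_measure_itv/= lte_fin.
case: ifPn; first by rewrite oppr0 adde0.
by rewrite -leNgt => r0'; congr (_%:E); apply/eqP; rewrite eq_le r0 r0'.
Qed.

Lemma uniform_prob01_itv : P [set v | (0 <= v <= 1)%R] = 1.
Proof.
by rewrite /P /uniform_prob integral_uniform_pdf1.
Qed.

(* The second coordinate, uniform on [0, 1], breaks the ties at the atoms of [h]:
   the law of the rank is Lebesgue measure on ]0, mu D[. *)
Definition rank (z : X * R) : \bar R := U (h z.1) + z.2%:E * p (h z.1).

Definition rank_lt (c : \bar R) : set (X * R) :=
  [set z | [/\ D z.1, (0 <= z.2 <= 1)%R & rank z < c]].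

Let rank_ge0 z : (0 <= z.2)%R -> 0 <= rank z.
Proof. by move=> z0; rewrite /rank adde_ge0// mule_ge0// lee_fin. Qed.

(** The rank of a point lies between the open and the closed tail at its value of [h]. If h > a, the
    closed tail there is below [c]; if h < a, the tail at the midpoint of h and a is at least [c]
    and at most the open tail at h. *)
Lemma rank_lt_threshold (c a : R) :
  (forall x, (a < x)%R -> V x < c%:E) ->
  (forall x, (0 <= x)%R -> (x < a)%R -> c%:E <= V x) ->
  (forall z, rank_lt c%:E z -> (a <= h z.1)%R) /\
  (forall z, D z.1 -> (0 <= z.2 <= 1)%R -> (a < h z.1)%R -> rank_lt c%:E z).
Proof.
move=> gtA ltA; split.
  move=> z [Dz /andP[z0 z1] rz]; rewrite leNgt; apply/negP => ha.
  have mid : (0 <= (h z.1 + a) / 2)%R /\ ((h z.1 + a) / 2 < a)%R /\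
             (h z.1 < (h z.1 + a) / 2)%R.
    by have := h_gt0 Dz; split; [|split]; lra.
  have := ltA _ mid.1 mid.2.1; apply/negP; rewrite -ltNge.
  apply: le_lt_trans rz; apply: (le_trans (V_le_U mid.2.2)).
  by rewrite /rank leeDl// mule_ge0// lee_fin.
move=> z Dz /andP[z0 z1] ah; split => //; first by rewrite z0.
apply: le_lt_trans (gtA _ ah); rewrite VE /rank leeD2l//.
by rewrite gee_pMl// ?lee_fin.
Qed.

Let rank_lt_decomp (c a : R) : (0 <= a)%R ->
  (forall x, (a < x)%R -> V x < c%:E) ->
  (forall x, (0 <= x)%R -> (x < a)%R -> c%:E <= V x) ->
  rank_lt c%:E =
   ((D `&` [set t | (a < h t)%R]) `*` [set v | (0 <= v <= 1)%R]) `|`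
   ((D `&` [set t | h t == a]) `*`
     [set v | (0 <= v <= 1)%R && (U a + v%:E * p a < c%:E)]).
Proof.
move=> a0 gtA ltA; have [r1 r2] := rank_lt_threshold gtA ltA.
apply/seteqP; split => [[x v] rz|[x v]].
  have := r1 _ rz; case: rz => /= Dx v01; rewrite /rank/= => rz.
  rewrite le_eqVlt => /predU1P[ax|ax]; [right|left]; split => //=.
    by split => //; rewrite ax.
  by rewrite ax v01 rz.
move=> [[[Dx /= ax] v01]|[[Dx /= /eqP xa] /andP[v01 rz]]]; first exact: r2.
by split => //=; rewrite /rank/= xa.
Qed.

Let p_fin a : (0 <= a)%R -> p a < +oo.
Proof.
rewrite le_eqVlt => /predU1P[<-|a0].
  rewrite /p (_ : _ `&` _ = set0) ?measure0//.
  by apply/seteqP; split => // t [/h_gt0 h0 /= /eqP ht]; move: h0; rewrite ht ltxx.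
apply: le_lt_trans (V_fin a0); rewrite VE leeDr//.
Qed.

(** The points above the threshold contribute U a, and since U a <= c <= U a + p a, a suitable
    fraction of the atom at [a] supplies exactly the missing mass. *)
Lemma rank_lt_measure (c : R) : (0 < c)%R -> c%:E <= mu D ->
  measurable (rank_lt c%:E) /\ (mu \x P) (rank_lt c%:E) = c%:E.
Proof.
move=> c0 cD; have [a a0 [gtA ltA Ua Va]] := threshold_exists c0 cD.
have [u Uau] : exists u, U a = u%:E.
  exists (fine (U a)); rewrite fineK// ge0_fin_numE//.
  by apply: le_lt_trans Ua _; rewrite ltry.
have [q paq] : exists q, p a = q%:E.
  by exists (fine (p a)); rewrite fineK// ge0_fin_numE// p_fin.
have q0 : (0 <= q)%R by rewrite -lee_fin -paq.
rewrite (rank_lt_decomp a0 gtA ltA).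
have uc : (u <= c)%R by rewrite -lee_fin -Uau.
have cuq : (c <= u + q)%R by rewrite -lee_fin EFinD -Uau -paq -VE.
(* [r] is the fraction of the atom to keep. Without an atom U a = c already, and the value 0 is a
   placeholder. *)
pose r := if q == 0%R then 0%R else ((c - u) / q)%R.
pose C := if q == 0%R then [set v : R | (0 <= v <= 1)%R && (u < c)%R]
          else [set v | (0 <= v <= 1)%R && (v < r)%R].
have CE : [set v : R | (0 <= v <= 1)%R && (U a + v%:E * p a < c%:E)] = C.
  apply/seteqP; rewrite /C /r Uau paq.
  have [->|q0'] := eqVneq q 0%R.
    by split => v /=; rewrite mule0 adde0 lte_fin.
  have q1 : (0 < q)%R by rewrite lt_neqAle eq_sym q0'.
  by split => v /=; rewrite -EFinM -EFinD lte_fin ltr_pdivlMr// ltrBrDl.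
have m01 : measurable [set v : R | (0 <= v <= 1)%R].
  by rewrite (_ : [set _ | _] = `[0%R, 1%R]%classic)//; apply/seteqP; split => v /=; rewrite in_itv.
have mC : measurable C.
  rewrite /C; case: ifPn => _; apply: measurable_pred; apply: measurable_and => //.
  - by apply: measurable_and; apply: measurable_fun_ler.
  - by apply: measurable_and; apply: measurable_fun_ler.
  - exact: measurable_fun_ltr.
rewrite CE; split.
  by apply: measurableU; apply: measurableX.
rewrite measureU//; first last.
- apply/seteqP; split => // -[x v] [[[_ /= ax] _] [[_ /= /eqP xa] _]].
  by move: ax; rewrite xa ltxx.
- exact: measurableX.
- exact: measurableX.
rewrite /= !product_measure1E//; transitivity (U a * P [set v | (0 <= v <= 1)%R] + p a * P C) => //.
rewrite uniform_prob01_itv mule1 Uau paq.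
have [q00|q0'] := eqVneq q 0%R.
  by rewrite q00 mul0e adde0; congr (_%:E); apply/eqP; rewrite eq_le uc; move: cuq; rewrite q00 addr0.
have q1 : (0 < q)%R by rewrite lt_neqAle eq_sym q0'.
rewrite /C (negbTE q0') uniform_prob01_lt.
- by rewrite -EFinM -EFinD /r (negbTE q0') mulrC divfK// addrC subrK.
- by rewrite /r (negbTE q0') divr_ge0// subr_ge0.
- by rewrite /r (negbTE q0') ler_pdivrMr// mul1r lerBlDl.
Qed.

Lemma rank_lt0 : rank_lt 0 = set0.
Proof.
by apply/seteqP; split => // z [_ /andP[z0 _]]; rewrite ltNge rank_ge0.
Qed.

End quantile_coupling.

(** * The quantile map *)

Section quantile_map.
Context (R : realType) (dX : measure_display) (X : measurableType dX).
Variables (mu : {measure set X -> \bar R}) (D : set X) (h : X -> R).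
Variable (nubar : {measure set R -> \bar R}).
Hypotheses (mD : measurable D) (mh : measurable_fun setT h).
Hypotheses (h_gt0 : forall x, D x -> (0 < h x)%R) (muD : mu (~` D) = 0).

Let V (x : R) : \bar R := mu (D `&` [set t | (x <= h t)%R]).
Let N (y : R) : \bar R := nubar `]y, +oo[%classic.
Let P := uniform_prob (@ltr01 R).
Let rlt := @rank_lt R dX X mu D h.

Hypotheses (V_fin : forall x, (0 < x)%R -> V x < +oo).
Hypotheses (V_small : forall c : R, (0 < c)%R -> exists2 x : R, (0 < x)%R & V x < c%:E).
Hypotheses (N_fin : forall y, (0 < y)%R -> N y < +oo).
Hypotheses (N_small : forall c : R, (0 < c)%R -> exists2 x : R, (0 < x)%R & N x < c%:E).
Hypotheses (N_le : forall y, (0 < y)%R -> N y <= mu D).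

Let N_mono x y : (x <= y)%R -> N y <= N x.
Proof.
move=> xy; apply: le_measure; rewrite ?inE; [exact: measurable_itv..|].
by move=> t /=; rewrite !in_itv/= !andbT; exact: le_lt_trans.
Qed.

Let N_real y : (0 < y)%R -> N y = 0 \/ exists2 c : R, (0 < c)%R & N y = c%:E.
Proof.
move=> y0; have Nf : N y \is a fin_num by rewrite ge0_fin_numE// N_fin.
have : 0 <= N y by exact: measure_ge0.
rewrite le_eqVlt => /predU1P[<-|Ny0]; [by left|right].
by exists (fine (N y)); [rewrite fine_gt0// Ny0 N_fin|rewrite fineK].
Qed.

Let rlt_mono x y z : (x <= y)%R -> rlt (N y) z -> rlt (N x) z.
Proof.
move=> xy [Dz z01 rz]; split => //; apply: (lt_le_trans rz); exact: N_mono.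
Qed.

Let rlt_measure y : (0 < y)%R ->
  measurable (rlt (N y)) /\ (mu \x P) (rlt (N y)) = N y.
Proof.
move=> y0; case: (N_real y0) => [->|[c c0 Nc]].
  by rewrite /rlt rank_lt0; split => //; rewrite measure0.
rewrite Nc; apply: rank_lt_measure => //.
by rewrite -Nc N_le.
Qed.

(** The points whose rank is below the tail of [nubar] at every level, where the quantile would be
    infinite. *)
Let Z := \bigcap_n rlt (N n.+1%:R).

Let mZ : measurable Z.
Proof. by apply: bigcapT_measurable => n; have [] := @rlt_measure n.+1%:R (ltr0Sn _ _). Qed.

Let Z0 : (mu \x P) Z = 0.
Proof.
apply/eqP; rewrite -measure_le0; apply/lee_addgt0Pr => e e0; rewrite add0e.
have [x x0 Nx] := N_small e0.
pose n := Num.truncn x.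
have xn : (x <= n.+1%:R)%R by exact/ltW/truncnS_gt.
have [mB BE] := @rlt_measure n.+1%:R (ltr0Sn _ _).
apply: (@le_trans _ _ ((mu \x P) (rlt (N n.+1%:R)))).
  by apply: le_measure; rewrite ?inE// => z; exact.
by rewrite BE; apply: (le_trans (N_mono xn)); exact: ltW.
Qed.

(* [sup (A z)] takes the junk value 0 when [A z] is unbounded, that is on the null
   set [Z]. *)
Let A z := [set y : R | y = 0%R \/ ((0 < y)%R /\ rlt (N y) z)].
Let T z := sup (A z).

Let A_bounded z : ~ Z z -> has_sup (A z).
Proof.
move=> nZ; split; first by exists 0%R; left.
have [n nz] : exists n, ~ rlt (N n.+1%:R) z.
  by apply/existsNP => H; apply: nZ => n _; exact: H.
exists n.+1%:R => y [->//|[y0 yz]].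
by rewrite leNgt; apply/negP => /ltW /rlt_mono /(_ yz).
Qed.

Let A_unbounded z : Z z -> T z = 0%R.
Proof.
move=> zZ; apply: sup_out => -[_ [b bA]].
pose n := Num.truncn b.
have : A z n.+1%:R by right; split => //; exact: zZ.
by move/bA; rewrite leNgt truncnS_gt.
Qed.

Let T_ge0 z : (0 <= T z)%R.
Proof.
have [/A_unbounded ->//|/A_bounded hA] := pselect (Z z).
by apply: (sup_upper_bound hA); left.
Qed.

(** Right-continuity of the tail of [nubar], which makes the inequality y < T z strict in [T_gt]. *)
Let N_rc y e : N y > e -> exists n : nat, e < N (y + n.+1%:R^-1)%R.
Proof.
move=> eN; apply: contrapT => /forallNP H.
have cov : `]y, +oo[%classic = \bigcup_n `](y + n.+1%:R^-1)%R, +oo[%classic.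
  apply/seteqP; split => [t /=|t [n _ /=]]; rewrite !in_itv/= !andbT => yt.
    exists (Num.truncn (t - y)^-1) => //=; rewrite in_itv/= andbT.
    rewrite -ltrBrDl invf_plt ?posrE ?ltr0n ?subr_gt0//.
    exact: truncnS_gt.
  by apply: lt_trans yt; rewrite ltrDl invr_gt0 ltr0n.
have mI n : measurable (`](y + n.+1%:R^-1)%R, +oo[%classic : set R).
  exact: measurable_itv.
have mc : measurable (\bigcup_n (`](y + n.+1%:R^-1)%R, +oo[%classic : set R)).
  by apply: bigcupT_measurable.
have nd : nondecreasing_seq (fun n => `](y + n.+1%:R^-1)%R, +oo[%classic : set R).
  move=> i j ij; apply/subsetPset => t /=; rewrite !in_itv/= !andbT.
  apply: le_lt_trans; rewrite lerD2l lef_pV2 ?posrE ?ltr0n// ler_nat ltnS.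
  exact: ij.
have : N y <= e.
  rewrite /N cov; apply: (cvge_to_le (nondecreasing_cvg_mu mI mc nd)).
  by apply: nearW => n; rewrite leNgt; apply/negP; exact: H.
by rewrite leNgt eN.
Qed.

(** [T] is the generalised inverse of [N] evaluated at the rank. If the rank is below N y, it is
    still below the tail at a slightly larger level, so the supremum is strictly above [y]. *)
Let T_gt y z : (0 < y)%R -> (y < T z)%R <-> (rlt (N y) z /\ ~ Z z).
Proof.
move=> y0; split => [yT|[[Dz z01 rz] nZ]].
  have nZ : ~ Z z by move/A_unbounded => T0; move: yT; rewrite T0 ltNge ltW.
  split => //; have [|y' Ay' yy'] := sup_gt _ yT; first by exists 0%R; left.
  case: Ay' yy' => [->|[y'0 y'z]]; first by rewrite ltNge ltW.
  by move=> /ltW /rlt_mono; exact.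
have [n rn] := N_rc rz.
have yn : (y < y + n.+1%:R^-1)%R by rewrite ltrDl invr_gt0 ltr0n.
apply: (lt_le_trans yn); apply: (sup_upper_bound (A_bounded nZ)); right.
by split; [exact: lt_trans yn|].
Qed.

Let T_gtE y : (0 < y)%R -> [set z | (y < T z)%R] = rlt (N y) `\` Z.
Proof. by move=> y0; apply/seteqP; split => z /= /(T_gt _ y0). Qed.

Let mT_gt y : (0 < y)%R -> measurable [set z | (y < T z)%R].
Proof.
by move=> y0; rewrite T_gtE//; apply: measurableD => //; have [] := rlt_measure y0.
Qed.

Let mT : measurable_fun setT T.
Proof.
move=> _; apply: (measurability _ (RGenOInfty.measurableE R)) => //.
move=> /= _ [_ [y ->] <-]; rewrite setTI.
rewrite (_ : _ @^-1` _ = [set z | (y < T z)%R]); last first.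
  by apply/seteqP; split => z /=; rewrite in_itv/= andbT.
have [y0|y0] := ltP y 0%R.
  rewrite (_ : [set _ | _] = setT)//; apply/seteqP; split => // z _ /=.
  exact: lt_le_trans (T_ge0 z).
move: y0; rewrite le_eqVlt => /predU1P[<-|y0]; last exact: mT_gt.
rewrite (_ : [set _ | _] = \bigcup_n [set z | (n.+1%:R^-1 < T z)%R]).
  by apply: bigcupT_measurable => n; apply: mT_gt; rewrite invr_gt0 ltr0n.
apply/seteqP; split => [z /= z0|z [n _ /=]]; last first.
  by apply: lt_trans; rewrite invr_gt0 ltr0n.
exists (Num.truncn (T z)^-1) => //=.
by rewrite invf_plt ?posrE ?ltr0n//; exact: truncnS_gt.
Qed.

Let T_law y : (0 < y)%R -> (mu \x P) [set z | (y < T z)%R] = N y.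
Proof.
move=> y0; have [mB BE] := rlt_measure y0.
pose M : {measure set (X * measurableTypeR R) -> \bar R} := (mu \x P).
have E : M (rlt (N y)) = M (rlt (N y) `\` Z) + M (rlt (N y) `&` Z).
  by apply: measureDI.
have MZ : M (rlt (N y) `&` Z) = 0.
  apply/eqP; rewrite eq_le measure_ge0 andbT.
  apply: (@le_trans _ _ (M Z)); last by rewrite [leLHS]Z0.
  by apply: le_measure; rewrite ?inE//; exact: measurableI.
have E2 : M (rlt (N y)) = M (rlt (N y) `\` Z) by rewrite E MZ adde0.
by rewrite (T_gtE y0); exact: (etrans (esym E2) BE).
Qed.

(** The threshold is that of [threshold_exists] for c = N y. As y < T z means that the rank is below
    N y, [rank_lt_threshold] gives the sandwich required by [level_ge]. *)
Lemma quantile_map_exists : exists T : X * R -> R,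
  [/\ measurable_fun setT T, forall z, (0 <= T z)%R,
      forall y, (0 < y)%R -> (mu \x P) [set z | (y < T z)%R] = N y &
      forall y, (0 < y)%R -> 0 < N y -> exists2 a : R, (0 <= a)%R &
        [/\ forall x, (a < x)%R -> V x < N y,
            forall x, (0 <= x)%R -> (x < a)%R -> N y <= V x &
            {ae (mu \x P), forall z,
              ((a < h z.1)%R -> (y < T z)%R) /\ ((y < T z)%R -> (a <= h z.1)%R)}]].
Proof.
exists T; split => // y y0 Ny0.
have [c c0 Nc] : exists2 c : R, (0 < c)%R & N y = c%:E.
  by case: (N_real y0) => // N0; move: Ny0; rewrite N0 ltxx.
have [|a a0 [gtA ltA _ _]] := threshold_exists mD mh h_gt0 V_fin V_small c0.
  by rewrite -Nc N_le.
exists a => //; rewrite Nc; split => //.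
have [r1 r2] := rank_lt_threshold mD mh h_gt0 gtA ltA.
have m01 : measurable [set v : R | (0 <= v <= 1)%R].
  by rewrite (_ : [set _ | _] = `[0%R, 1%R]%classic)//; apply/seteqP; split => v /=; rewrite in_itv.
have mB1 : measurable (~` D `*` [set: R]) by apply: measurableX => //; exact: measurableC.
have mB2 : measurable ([set: X] `*` ~` [set v : R | (0 <= v <= 1)%R]).
  by apply: measurableX => //; exact: measurableC.
have B1 : (mu \x P) (~` D `*` [set: R]) = 0.
  rewrite product_measure1E; [|exact: measurableC|by []].
  by rewrite muD mul0e.
have B2 : (mu \x P) ([set: X] `*` ~` [set v : R | (0 <= v <= 1)%R]) = 0.
  rewrite product_measure1E; [|by []|exact: measurableC].
  pose P' : probability (measurableTypeR R) R := P.
  have PC : P' (~` [set v : R | (0 <= v <= 1)%R]) = 0.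
    rewrite probability_setC//; apply/eqP; rewrite sube_eq//.
    by rewrite add0e eq_sym; apply/eqP; exact: uniform_prob01_itv.
  exact: (etrans (congr1 (fun t => mu setT * t) PC) (mule0 _)).
have neg (B : set (X * R)) : measurable B -> (mu \x P) B = 0 -> (mu \x P).-negligible B.
  by move=> mB B0; exists B; split.
(* Three null sets are discarded: first coordinate outside [D], second coordinate outside [0, 1],
   and [Z]. *)
apply: negligibleS (negligibleU (neg _ mB1 B1) (negligibleU (neg _ mB2 B2) (neg _ mZ Z0))).
move=> z /= nz; apply: contrapT => nB; apply: nz.
have Dz : D z.1 by apply: contrapT => nD; apply: nB; left.
have z01 : (0 <= z.2 <= 1)%R by apply: contrapT => nD; apply: nB; right; left.
have nZ : ~ Z z by move=> ?; apply: nB; right; right.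
split => [az|].
  by apply/(T_gt _ y0); split => //; rewrite Nc; exact: r2.
by move=> /(T_gt _ y0)[+ _]; rewrite Nc; exact: r1.
Qed.

End quantile_map.

(** * Tail bounds from second moments *)

(** Chebyshev's inequality: the tail at [t] is at most the integral of [q] divided by k t^2. *)
Lemma tail_of_integrable (R : realType) dX (X : measurableType dX)
    (mu : {measure set X -> \bar R}) (D : set X) (h q : X -> R) (k : R) :
  measurable D -> measurable_fun setT h -> measurable_fun setT q ->
  (forall x, 0 <= q x)%R -> \int[mu]_(x in D) (q x)%:E < +oo -> (0 < k)%R ->
  (forall x t, D x -> (0 < t)%R -> (t <= h x)%R -> (k * t ^+ 2 <= q x)%R) ->
  (forall t, (0 < t)%R -> mu (D `&` [set x | (t <= h x)%R]) < +oo) /\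
  (forall c : R, (0 < c)%R ->
    exists2 t : R, (0 < t)%R & mu (D `&` [set x | (t <= h x)%R]) < c%:E).
Proof.
move=> mD mh mq q0 Ioo k0 hq.
have Ifin : \int[mu]_(x in D) (q x)%:E \is a fin_num.
  by rewrite ge0_fin_numE// integral_ge0// => x _; rewrite lee_fin.
pose M := fine (\int[mu]_(x in D) (q x)%:E).
have M0 : (0 <= M)%R by rewrite fine_ge0// integral_ge0// => x _; rewrite lee_fin.
have bound t : (0 < t)%R ->
    mu (D `&` [set x | (t <= h x)%R]) <= ((k * t ^+ 2)^-1 * M)%:E.
  move=> t0; have kt0 : (0 < k * t ^+ 2)%R by rewrite mulr_gt0// exprn_gt0.
  rewrite EFinM lee_pdivlMl// /M fineK//.
  have mqD : measurable_fun D (fun x => (q x)%:E).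
    by apply: measurable_funTS; apply/measurable_EFinP.
  apply: (@le_trans _ _ ((k * t ^+ 2)%:E * mu (D `&` [set x | (k * t ^+ 2)%:E <= `|(q x)%:E|]))).
    apply: lee_wpmul2l; first by rewrite lee_fin ltW.
    apply: le_measure; rewrite ?inE.
    + by apply: measurableI => //; apply: measurable_pred; exact: measurable_fun_ler.
    + by apply: emeasurable_fun_c_infty => //; exact: measurableT_comp.
    + by move=> x [Dx /= tx]; split => //=; rewrite lee_fin ger0_norm// hq.
  apply: (le_trans (le_integral_abse mu mD mqD kt0)).
  by under eq_integral do rewrite gee0_abs ?lee_fin//.
split => [t t0|c c0]; first by rewrite (le_lt_trans (bound _ t0))// ltry.
(* With t = M / (c k) + 1 one has k t c = M + k c > M, and t >= 1 gives t^2 >= t, so the Chebyshev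
   bound is below [c]. *)
have t1 : (1 <= M / (c * k) + 1)%R by rewrite lerDr divr_ge0// mulr_ge0// ltW.
have t0 : (0 < M / (c * k) + 1)%R by exact: lt_le_trans t1.
exists (M / (c * k) + 1)%R => //; rewrite (le_lt_trans (bound _ t0))// lte_fin.
rewrite ltr_pdivrMl; last by rewrite mulr_gt0// exprn_gt0.
apply: (@lt_le_trans _ _ (k * (M / (c * k) + 1) * c)%R).
  rewrite mulrAC mulrDr mulr1 mulrC (mulrC k) divfK ?mulf_neq0 ?gt_eqF//.
  by rewrite ltrDl mulr_gt0.
by rewrite ler_pM2r// ler_pM2l// expr2 ler_peMr// ltW.
Qed.

(** Cauchy-Schwarz against (1, ..., 1), obtained from the nonnegativity of the sum of squared
    deviations from the mean [m]. *)
Lemma sqr_tsum_le (R : realType) d (s : d.-tuple R) :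
  (tsum s ^+ 2 <= d%:R * sqnorm s)%R.
Proof.
case: d s => [s|d s]; first by rewrite /tsum big_ord0 expr0n mul0r.
have d0 : (0 < d.+1%:R :> R)%R by rewrite ltr0n.
pose m := (tsum s / d.+1%:R)%R.
have : (0 <= \sum_(i < d.+1) (tnth s i - m) ^+ 2)%R.
  by apply: sumr_ge0 => i _; exact: sqr_ge0.
have -> : (\sum_(i < d.+1) (tnth s i - m) ^+ 2 =
    sqnorm s - 2 * m * tsum s + d.+1%:R * m ^+ 2)%R.
  rewrite /sqnorm /tsum mulr_sumr -sumrB.
  have -> : (d.+1%:R * m ^+ 2 = \sum_(i < d.+1) m ^+ 2)%R.
    by rewrite sumr_const card_ord mulr_natl.
  by rewrite -big_split/=; apply: eq_bigr => i _; lra.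
have mE : tsum s = (m * d.+1%:R)%R by rewrite /m divfK// gt_eqF.
rewrite mE => H; have := mulr_ge0 (ltW d0) H; nra.
Qed.

(** * The comonotone coupling of nu and nu_co *)

Section comonotone_coupling.
Context (R : realType) (d : nat) (i0 : 'I_d).
Variables (nu : {measure set (d.-tuple R) -> \bar R}).
Variables (nubar : {measure set R -> \bar R}).
Hypotheses (hnu : inM2 nu) (hnubar : inM2_1 nubar) (hmarg : has_marginals nu nubar).

Definition sum_tail (x : R) : \bar R :=
  nu (Omega d `&` [set s | (x <= tsum s)%R]).

Lemma tsum_gt0 (s : d.-tuple R) : Omega d s -> (0 < tsum s)%R.
Proof.
move=> [s0 [i si]]; rewrite /tsum (bigD1 i)//= ltr_pwDl ?lt_neqAle 1?eq_sym ?si ?s0//.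
exact: sumr_ge0.
Qed.

Lemma sum_tail_bounds :
  (forall t, (0 < t)%R -> sum_tail t < +oo) /\
  (forall c : R, (0 < c)%R -> exists2 t : R, (0 < t)%R & sum_tail t < c%:E).
Proof.
have d0 : (0 < d%:R :> R)%R by rewrite ltr0n (leq_trans _ (ltn_ord i0)).
apply: (@tail_of_integrable R _ _ nu (Omega d) (@tsum R d) (@sqnorm R d) d%:R^-1).
- exact: measurable_Omega.
- exact: measurable_tsum.
- exact: measurable_sqnorm.
- exact: sqnorm_ge0.
- by case: hnu.
- by rewrite invr_gt0.
- move=> s t sO t0 ts; rewrite ler_pdivrMl//; apply: le_trans (sqr_tsum_le s).
  by have tS := lt_le_trans t0 ts; rewrite ler_sqr// nnegrE ltW.
Qed.

Lemma ray_tail_bounds :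
  (forall y : R, (0 < y)%R -> nubar `]y, +oo[%classic < +oo) /\
  (forall c : R, (0 < c)%R ->
    exists2 y : R, (0 < y)%R & nubar `]y, +oo[%classic < c%:E).
Proof.
have [|||||||f1 f2] := @tail_of_integrable R _ _ nubar Omega1 id (fun x => (x ^+ 2)%R) 1%R.
- exact: measurable_Omega1.
- exact: measurable_id.
- exact: measurable_funX.
- by move=> x; rewrite sqr_ge0.
- by case: hnubar.
- exact: ltr01.
- by move=> x t x0 t0 tx; rewrite mul1r ler_sqr// nnegrE ltW.
have le y : (0 < y)%R -> nubar `]y, +oo[%classic <= nubar (Omega1 `&` [set x | (y <= x)%R]).
  move=> y0; apply: le_measure; rewrite ?inE; first exact: measurable_itv.
    apply: measurableI; first exact: measurable_Omega1.
    by apply: measurable_pred; exact: measurable_fun_ler.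
  move=> x /=; rewrite in_itv/= andbT => yx; split; last exact: ltW.
  exact: lt_trans yx.
split => [y y0|c c0]; first exact: le_lt_trans (le _ y0) (f1 _ y0).
by have [t t0 ft] := f2 _ c0; exists t => //; exact: le_lt_trans (le _ t0) ft.
Qed.

(** This guarantees that [nu] has enough mass for the rank to reach every tail value of [nubar]. *)
Lemma ray_le_nu_Omega (y : R) : (0 < y)%R ->
  nubar `]y, +oo[%classic <= nu (Omega d).
Proof.
move=> y0; have mI : measurable (`]y, +oo[%classic : set R) by exact: measurable_itv.
rewrite -(hmarg i0 mI); last first.
  by move=> x /=; rewrite in_itv/= andbT; exact: lt_trans.
rewrite /pushforward.
have mB : measurable ((fun s : d.-tuple R => tnth s i0) @^-1` `]y, +oo[%classic).
  by rewrite -[X in measurable X]setTI; exact: measurable_tnth.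
have mO := @measurable_Omega R d.
have -> : nu (Omega d) = nu (Omega d) + nu (~` Omega d) by rewrite hnu.1 adde0.
rewrite -measureU//; last 2 first.
- exact: measurableC.
- by rewrite setICr.
by apply: le_measure; rewrite ?inE// setUCr.
Qed.

Definition glue (sv : d.-tuple R * R) : (d + d).-tuple R :=
  [tuple match fintype.split i with inl j => tnth sv.1 j | inr _ => sv.2 end | i < d + d].

Lemma fst_part_glue sv : fst_part (glue sv) = sv.1.
Proof.
apply: eq_from_tnth => i; rewrite !tnth_mktuple.
by rewrite (unsplitK (inl i)).
Qed.

Lemma snd_part_glue sv : snd_part (glue sv) = diag d sv.2.
Proof.
apply: eq_from_tnth => i; rewrite !tnth_mktuple.
by rewrite (unsplitK (inr i)).
Qed.

Lemma Omega_glue sv : Omega d sv.1 -> (0 <= sv.2)%R -> Omega (d + d) (glue sv).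
Proof.
move=> [s0 [i si]] v0; split => [j|].
  by rewrite tnth_mktuple; case: fintype.split.
by exists (lshift d i); rewrite tnth_mktuple (unsplitK (inl i)).
Qed.

Lemma sqnorm_split (z : (d + d).-tuple R) :
  sqnorm z = (sqnorm (fst_part z) + sqnorm (snd_part z))%R.
Proof.
by rewrite /sqnorm big_split_ord/=; congr (_ + _)%R; apply: eq_bigr => i _; rewrite tnth_mktuple.
Qed.

Lemma nu_co_sqnorm_fin : \int[nu_co d nubar]_(s in Omega d) (sqnorm s)%:E < +oo.
Proof.
rewrite (@integral_sqnorm _ _ nubar (nu_co d nubar)).
- by apply: lte_sum_pinfty => i _; case: hnubar.
- by apply: nu_co_setCOmega => //; case: hnubar.
- exact: nu_co_has_marginals.
Qed.

(** The coupling is the image of [nu] times the uniform law under (s, v) |-> (s, T(s, v), ..., T(s,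
    v)), with [T] the quantile map for h = S. Its first marginal is [nu] because the uniform law has
    mass 1. *)
Lemma comonotone_coupling_exists :
  exists2 g : {measure set ((d + d).-tuple R) -> \bar R},
    couplings nu (nu_co d nubar) g &
    forall y, (0 < y)%R -> 0 < nubar `]y, +oo[%classic ->
      exists2 a : R, (0 <= a)%R &
      [/\ forall x, (a < x)%R -> sum_tail x < nubar `]y, +oo[%classic,
          forall x, (0 <= x)%R -> (x < a)%R -> nubar `]y, +oo[%classic <= sum_tail x &
          {ae g, forall z, Omega (d + d) z ->
            ((a < tsum (fst_part z))%R -> (y < height i0 z)%R) /\
            ((y < height i0 z)%R -> (a <= tsum (fst_part z))%R)}].
Proof.
have mO := @measurable_Omega R d.
have mO2 := @measurable_Omega R (d + d).
have [nub0 _] := hnubar; have [nu0 nufin] := hnu.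
have [Vfin Vsmall] := sum_tail_bounds.
have [Nfin Nsmall] := ray_tail_bounds.
have [T [mT T0 Tlaw Tthr]] := @quantile_map_exists R _ _ nu (Omega d) (@tsum R d) nubar
  mO (@measurable_tsum R d) tsum_gt0 nu0 Vfin Vsmall Nfin Nsmall ray_le_nu_Omega.
pose P := uniform_prob (@ltr01 R).
(* [uniform_prob] is a measure on [measurableTypeR R], which has the carrier of
   [R] but another display. *)
pose M : {measure set (d.-tuple R * measurableTypeR R) -> \bar R} := (nu \x P).
pose Phi (z : d.-tuple R * measurableTypeR R) := glue (z.1, T z).
have mPhi : measurable_fun setT Phi.
  apply/measurable_fun_tnthP => i.
  case E : (fintype.split i) => [j|j].
    rewrite (_ : _ \o _ = (fun s => tnth s j) \o fst).
      exact: (measurableT_comp (measurable_tnth j) measurable_fst).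
    by apply/funext => z /=; rewrite tnth_mktuple E.
  rewrite (_ : _ \o _ = T); first exact: mT.
  by apply/funext => z /=; rewrite tnth_mktuple E.
pose g : {measure set ((d + d).-tuple R) -> \bar R} :=
  measure_function_pushforward__canonical__measure_function_Measure M mPhi.
have g1 : forall A : set (d.-tuple R), measurable A -> A `<=` Omega d ->
      pushforward g (@fst_part R d) A = nu A.
  move=> A mA _.
  transitivity (M (A `*` setT)).
    rewrite /g/= /pushforward; congr (M _).
    by apply/seteqP; split => z /=; rewrite fst_part_glue// => -[].
  transitivity (nu A * P setT); first exact: product_measure1E.
  by rewrite [X in _ * X](_ : _ = 1) ?mule1//; exact: (@probability_setT _ _ _ (P : probability (measurableTypeR R) R)).
have mT' : measurable_fun [set: d.-tuple R * measurableTypeR R] (T : _ -> R) by exact: mT.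
pose lawT : {measure set R -> \bar R} :=
  measure_function_pushforward__canonical__measure_function_Measure M mT'.
(* The law of [T] may also charge 0, so it is identified with [nubar] on positive levels only. *)
have lawE : forall A, measurable A -> A `<=` Omega1 -> lawT A = nubar A.
  have rayE y : (0 < y)%R -> lawT `]y, +oo[%classic = nubar `]y, +oo[%classic.
    move=> y0; transitivity (M [set z | (y < T z)%R]); last exact: Tlaw.
    rewrite (_ : [set z | _] = T @^-1` `]y, +oo[%classic); first by [].
    by apply/seteqP; split => z /=; rewrite in_itv/= andbT.
  by apply: measure_eq_on_pos => // y y0; rewrite rayE// Nfin.
have g2 : forall A : set (d.-tuple R), measurable A -> A `<=` Omega d ->
      pushforward g (@snd_part R d) A = nu_co d nubar A.
  move=> A mA AO.
  transitivity (lawT (@diag R d @^-1` A)).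
    rewrite /g/= /pushforward; congr (M _).
    by apply/seteqP; split => z /=; rewrite snd_part_glue.
  apply: lawE; last by move=> x /AO /(Omega_diag i0).
  by rewrite -[X in measurable X]setTI; exact: measurable_diag.
have g0 : g (~` Omega (d + d)) = 0.
  apply/eqP; rewrite eq_le measure_ge0 andbT.
  have <- : M (~` Omega d `*` setT) = 0.
    transitivity (nu (~` Omega d) * P setT); last by rewrite nu0 mul0e.
    by apply: product_measure1E => //; exact: measurableC.
  rewrite /g/= /pushforward; apply: le_measure; rewrite ?inE.
  - by rewrite -[X in measurable X]setTI; apply: (mPhi measurableT); exact: measurableC.
  - by apply: measurableX => //; exact: measurableC.
  - by move=> z /= H; split => //= zO; apply: H; exact: (@Omega_glue (z.1, T z) zO (T0 z)).
have gM2 : inM2 g.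
  split => //.
  under eq_integral do rewrite sqnorm_split EFinD.
  have mq : measurable_fun setT (fun s : d.-tuple R => (sqnorm s)%:E).
    by apply/measurable_EFinP; exact: measurable_sqnorm.
  have q0 (s : d.-tuple R) : 0 <= (sqnorm s)%:E by rewrite lee_fin sqnorm_ge0.
  have qz (s : d.-tuple R) : (forall i, tnth s i = 0%R) -> (sqnorm s)%:E = 0.
    by move=> s0; rewrite /sqnorm big1// => i _; rewrite s0 expr0n.
  rewrite ge0_integralD//; last 2 first.
  - by apply: measurable_funTS; apply: (measurableT_comp mq); exact: measurable_fst_part.
  - by apply: measurable_funTS; apply: (measurableT_comp mq); exact: measurable_snd_part.
  rewrite (@ge0_integral_marginal _ _ _ _ _ g nu (@fst_part R d) _ (Omega d) (fun s => (sqnorm s)%:E))//; last 2 first.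
  - exact: measurable_fst_part.
  - by move=> z zO zN; apply: qz; apply: notin_Omega => //; exact: fst_part_ge0.
  rewrite (@ge0_integral_marginal _ _ _ _ _ g (nu_co d nubar) (@snd_part R d) _ (Omega d) (fun s => (sqnorm s)%:E))//; last 2 first.
  - exact: measurable_snd_part.
  - by move=> z zO zN; apply: qz; apply: notin_Omega => //; exact: snd_part_ge0.
  by rewrite lte_add_pinfty// nu_co_sqnorm_fin.
exists g => // y y0 Ny0; have [a a0 [gtA ltA aeT]] := Tthr y y0 Ny0.
exists a => //; split => //.
(* To carry the sandwich over to the image measure, the exceptional set is written as a measurable
   set of the target; its preimage lies in the null set provided by the quantile map. *)
pose W := [set z : (d + d).-tuple R |
  ~~ (((a < tsum (fst_part z))%R ==> (y < height i0 z)%R) &&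
      ((y < height i0 z)%R ==> (a <= tsum (fst_part z))%R))].
have mfs : measurable_fun setT (fun z : (d + d).-tuple R => tsum (fst_part z)).
  exact: (measurableT_comp (@measurable_tsum R d) (@measurable_fst_part R d)).
have mW : measurable W.
  apply: measurable_pred; apply: measurable_neg; apply: measurable_and.
    under eq_fun do rewrite implybE.
    apply: measurable_or; first apply: measurable_neg; apply: measurable_fun_ltr => //.
    exact: measurable_height.
  under eq_fun do rewrite implybE.
  apply: measurable_or; first apply: measurable_neg.
    by apply: measurable_fun_ltr => //; exact: measurable_height.
  exact: measurable_fun_ler.
exists W; split; first exact: mW.
  case: aeT => B [mB B0 BW].
  apply/eqP; rewrite eq_le measure_ge0 andbT.
  have <- : M B = 0 by exact: B0.
  rewrite /g/= /pushforward; apply: le_measure; rewrite ?inE//.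
    by rewrite -[X in measurable X]setTI; apply: (mPhi measurableT).
  move=> z; rewrite /W/= /height fst_part_glue snd_part_glue tnth_mktuple/= => zW.
  by apply: BW => /= -[h1 h2]; move/negP: zW; apply; apply/andP; split; exact/implyP.
move=> z /= /not_implyP[zO nz]; apply/negP => /andP[/implyP h1 /implyP h2].
exact: nz.
Qed.

End comonotone_coupling.

(** * Comparison with nu_perp *)

(** Continuity from below along the sets where h >= 1/(n+1). Used by contraposition: if [D] has mass
    above [c], so has some set where [h] is at least a positive [t]. *)
Lemma measure_pos_le (R : realType) dX (X : measurableType dX)
    (mu : {measure set X -> \bar R}) (D : set X) (h : X -> R) (c : \bar R) :
  measurable D -> measurable_fun setT h -> (forall x, D x -> (0 < h x)%R) ->
  (forall t : R, (0 < t)%R -> mu (D `&` [set x | (t <= h x)%R]) <= c) -> mu D <= c.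
Proof.
move=> mD mh h0 hc.
pose F n := D `&` [set x | (n.+1%:R^-1 <= h x)%R].
have cov : D = \bigcup_n F n.
  apply/seteqP; split => [x Dx|x [n _ []]//].
  exists (Num.truncn (h x)^-1) => //; split => //=.
  by rewrite invf_ple ?posrE ?ltr0n ?h0//; exact/ltW/truncnS_gt.
have mF n : measurable (F n).
  by apply: measurableI => //; apply: measurable_pred; exact: measurable_fun_ler.
have mc : measurable (\bigcup_n F n) by rewrite -cov.
have nd : nondecreasing_seq F.
  move=> i j ij; apply/subsetPset => x [Dx /= ix]; split => //=.
  by apply: le_trans ix; rewrite lef_pV2 ?posrE ?ltr0n// ler_nat ltnS.
rewrite cov; apply: (cvge_to_le (nondecreasing_cvg_mu mF mc nd)).
by apply: nearW => n; apply: hc; rewrite invr_gt0 ltr0n.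
Qed.

Section nu_perp.
Context (R : realType) (d : nat) (nubar : {measure set R -> \bar R}).

Lemma Omega_axis (j : 'I_d) (x : R) : Omega d (axis j x) <-> (0 < x)%R.
Proof.
split=> [[x0 [i]]|x0].
  rewrite tnth_mktuple; case: ifP => [_ xn0|_ /eqP//].
  by rewrite lt_neqAle eq_sym xn0/=; have := x0 j; rewrite tnth_mktuple eqxx.
split => [i|]; first by rewrite tnth_mktuple; case: ifP => // _; exact: ltW.
by exists j; rewrite tnth_mktuple eqxx gt_eqF.
Qed.

Lemma nu_perp_setCOmega : nubar (~` Omega1) = 0 -> nu_perp d nubar (~` Omega d) = 0.
Proof.
move=> nub0; rewrite /= /nu_perp big1// => j _; rewrite -[RHS]nub0 /pushforward.
congr (nubar _).
by apply/seteqP; split => x /= h xx; apply: h; exact/(Omega_axis j).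
Qed.

Lemma nu_perp_has_marginals : has_marginals (nu_perp d nubar) nubar.
Proof.
move=> i A mA A1; rewrite /= /nu_perp /pushforward (bigD1 i)//=.
rewrite big1 ?adde0 => [|j ji].
  by congr (nubar _); apply/seteqP; split => x /=; rewrite tnth_mktuple eqxx.
rewrite -(measure0 nubar); congr (nubar _).
apply/seteqP; split => x //=; rewrite tnth_mktuple eq_sym (negbTE ji).
by move/A1; rewrite /Omega1/= ltxx.
Qed.

Lemma tsum_axis (j : 'I_d) (x : R) : tsum (axis j x) = x.
Proof.
rewrite /tsum (bigD1 j)//= big1 ?addr0 ?tnth_mktuple ?eqxx// => i ij.
by rewrite tnth_mktuple (negbTE ij).
Qed.

Lemma excess0 (a : R) : (0 <= a)%R -> excess a 0 = 0%R.
Proof. by move=> a0; rewrite /excess sub0r max_r// oppr_le0. Qed.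

(** On an axis at most one coordinate is nonzero and the excess of 0 is 0, so the excess of the sum
    is the sum of the excesses; the latter integrates to a quantity of the marginals. *)
Lemma integral_excess_nu_perp (a : R) : nubar (~` Omega1) = 0 -> (0 <= a)%R ->
  \int[nu_perp d nubar]_(s in Omega d) (excess a (tsum s))%:E =
  \sum_(i < d) \int[nubar]_(x in Omega1) (excess a x)%:E.
Proof.
move=> nub0 a0.
have mes : measurable_fun setT (fun s : d.-tuple R => excess a (tsum s)).
  exact: (measurableT_comp (measurable_excess a) (@measurable_tsum R d)).
have mse : measurable_fun setT
    (fun s : d.-tuple R => (\sum_(i < d) excess a (tnth s i))%R).
  apply: measurable_sum => i.
  exact: (measurableT_comp (measurable_excess a) (measurable_tnth i)).
rewrite -(@integral_sum_marginals _ _ nubar (nu_perp d nubar) (excess a)); last 5 first.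
- exact: nu_perp_setCOmega.
- exact: nu_perp_has_marginals.
- exact: measurable_excess.
- exact: excess_ge0.
- exact: excess0.
apply: ge0_ae_eq_integral.
- exact: measurable_Omega.
- by apply: measurable_funTS; exact/measurable_EFinP.
- by apply: measurable_funTS; exact/measurable_EFinP.
- by move=> s _; rewrite lee_fin excess_ge0.
- by move=> s _; rewrite lee_fin sumr_ge0// => i _; exact: excess_ge0.
pose W := Omega d `&` [set s : d.-tuple R |
   ~~ (excess a (tsum s) == \sum_(i < d) excess a (tnth s i))%R].
exists W; split.
- apply: measurableI; first exact: measurable_Omega.
  by apply: measurable_pred; apply: measurable_neg; exact: measurable_fun_eqr.
- rewrite /= /nu_perp big1// => j _; rewrite /pushforward -(measure0 nubar).
  congr (nubar _); apply/seteqP; split => // x [_ /=]; rewrite tsum_axis.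
  rewrite (bigD1 j)//= big1 ?addr0 ?tnth_mktuple ?eqxx// => i ij.
  by rewrite tnth_mktuple (negbTE ij) excess0.
- move=> s /= /not_implyP[sO sW]; split => //; apply/negP => /eqP e.
  by apply: sW; rewrite e.
Qed.

Definition two_pos (i j : 'I_d) : set (d.-tuple R) :=
  Omega d `&` [set s | (0 < tnth s i)%R && (0 < tnth s j)%R].

Lemma measurable_two_pos i j : measurable (two_pos i j).
Proof.
apply: measurableI; first exact: measurable_Omega.
by apply: measurable_pred; apply: measurable_and; apply: measurable_fun_ltr => //;
  exact: measurable_tnth.
Qed.

(** Almost every point has exactly one positive coordinate, so 1_A(s) is the sum over j of 1_{s_j >
    0} 1_A(s_j e_j), and each term depends on a single marginal. *)
Lemma nu_eq_nu_perp (nu : {measure set (d.-tuple R) -> \bar R}) :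
  nu (~` Omega d) = 0 -> nubar (~` Omega1) = 0 -> has_marginals nu nubar ->
  (forall i j, i != j -> nu (two_pos i j) = 0) ->
  forall A, measurable A -> nu A = nu_perp d nubar A.
Proof.
move=> nu0 nub0 hm ntp A mA.
have mO := @measurable_Omega R d.
(* The factor 1_{x > 0} makes [f j] vanish at 0, where the marginals are not controlled. *)
pose f (j : 'I_d) (x : R) : \bar R := (((0 < x)%R%:R * \1_A (axis j x))%R)%:E.
have mf j : measurable_fun setT (f j).
  apply/measurable_EFinP; apply: measurable_funM.
    by apply: measurable_bool_natr; exact: measurable_fun_ltr.
  apply: (measurableT_comp (measurable_indic _)) => //; exact: measurable_axis.
have f0 j x : 0 <= f j x by rewrite lee_fin mulr_ge0.
transitivity (\int[nu]_(s in Omega d) (\1_A s)%:E).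
  rewrite integral_indic//.
  transitivity (nu (A `&` Omega d) + nu (A `&` ~` Omega d)).
    rewrite -measureU; last 3 first.
    + exact: measurableI.
    + by apply: measurableI => //; exact: measurableC.
    + by apply/seteqP; split => // s [[_ ?] [_ ?]].
    by rewrite -setIUr setUCr setIT.
  rewrite [X in _ + X](_ : _ = 0) ?adde0//.
  apply/eqP; rewrite eq_le measure_ge0 andbT -[leRHS]nu0.
  apply: le_measure; rewrite ?inE//; last exact: measurableC.
  by apply: measurableI => //; exact: measurableC.
transitivity (\int[nu]_(s in Omega d) \sum_(j < d) f j (tnth s j)).
  apply: ge0_ae_eq_integral => //.
  - by apply: measurable_funTS; apply/measurable_EFinP; exact: measurable_indic.
  - apply: measurable_funTS; apply: emeasurable_sum => j.
    by apply: (measurableT_comp (mf j)); exact: measurable_tnth.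
  - by move=> s _; exact: sume_ge0.
  have ae_tp : {ae nu, forall s, forall i j, i != j -> ~ two_pos i j s}.
    have h (ij : 'I_d * 'I_d) : {ae nu, forall s, ij.1 != ij.2 -> ~ two_pos ij.1 ij.2 s}.
      have [ij1|ij1] := boolP (ij.1 != ij.2); last by apply: aeW => s.
      exists (two_pos ij.1 ij.2); split; [exact: measurable_two_pos|exact: ntp|].
      by move=> s /= /not_implyP[_ /contrapT].
    have : {ae nu, forall s, forall ij : 'I_d * 'I_d, ij.1 != ij.2 -> ~ two_pos ij.1 ij.2 s}.
      exact: filter_forall.
    by apply: filterS => s H i j ij; exact: (H (i, j)).
  move: ae_tp; apply: filterS => s H sO.
  have [s0 [j sj]] := sO.
  have sj0 : (0 < tnth s j)%R by rewrite lt_neqAle eq_sym sj s0.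
  have sE : s = axis j (tnth s j).
    apply: eq_from_tnth => i; rewrite tnth_mktuple; case: eqP => [->//|/eqP ij].
    apply/eqP; apply: contrapT => /negP si; apply: (H i j ij); split => //=.
    by rewrite sj0 lt_neqAle eq_sym si s0.
  rewrite (bigD1 j)//= big1 => [|i ij].
    by rewrite adde0 /f sj0 mul1r -sE.
  by rewrite /f (_ : tnth s i = 0%R) ?ltxx ?mul0r// sE tnth_mktuple (negbTE ij).
rewrite ge0_integral_sum//; last first.
  by move=> j; apply: measurable_funTS; apply: (measurableT_comp (mf j)); exact: measurable_tnth.
rewrite /= /nu_perp; apply: eq_bigr => j _.
rewrite (@integral_marginal _ _ nubar nu j (f j))//; last by rewrite /f ltxx mul0r.
rewrite /pushforward.
have mjA : measurable (axis j @^-1` A).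
  by rewrite -[X in measurable X]setTI; exact: measurable_axis.
transitivity (\int[nubar]_(x in Omega1) (\1_(axis j @^-1` A) x)%:E).
  by apply: eq_integral => x; rewrite inE /Omega1/= => x0; rewrite /f x0 mul1r.
rewrite integral_indic//; last exact: measurable_Omega1.
transitivity (nubar (axis j @^-1` A `&` Omega1) + nubar (axis j @^-1` A `&` ~` Omega1)).
  rewrite [X in _ = _ + X](_ : _ = 0) ?adde0//.
  apply/eqP; rewrite eq_le measure_ge0 andbT -[leRHS]nub0.
  have mC : measurable (~` Omega1 : set R) by apply: measurableC; exact: measurable_Omega1.
  by apply: le_measure; rewrite ?inE//; exact: measurableI.
rewrite -measureU.
- by rewrite -setIUr setUCr setIT.
- by apply: measurableI => //; exact: measurable_Omega1.
- by apply: measurableI => //; apply: measurableC; exact: measurable_Omega1.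
- by apply/seteqP; split => // s [[_ ?] [_ ?]].
Qed.

End nu_perp.

(** * Comparing costs level by level *)

Definition coupling_cost (R : realType) d (g : {measure set ((d + d).-tuple R) -> \bar R}) : \bar R :=
  \int[g]_(z in Omega (d + d)) (sqnorm (tsub (fst_part z) (snd_part z)))%:E.

Definition level_integral (R : realType) d (i0 : 'I_d)
    (g : {measure set ((d + d).-tuple R) -> \bar R}) (y : R) : \bar R :=
  \int[g]_(z in Omega (d + d)) (if (y < height i0 z)%R then tsum (fst_part z) else 0%R)%:E.

Section comparison.
Context (R : realType) (d : nat) (i0 : 'I_d).
Variables (nu : {measure set (d.-tuple R) -> \bar R}).
Variables (nubar : {measure set R -> \bar R}).
Hypotheses (hnu : inM2 nu) (hnubar : inM2_1 nubar) (hmarg : has_marginals nu nubar).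

(** Superadditivity of the excess, improved by [a] on [E]. The empty [E] gives the plain comparison,
    a set with two large coordinates the strict one. *)
Lemma integral_excess_ge (a : R) (E : set (d.-tuple R)) :
  (0 <= a)%R -> measurable E -> E `<=` Omega d ->
  (forall s, E s -> (\sum_(i < d) excess a (tnth s i) + a <= excess a (tsum s))%R) ->
  \sum_(i < d) \int[nubar]_(x in Omega1) (excess a x)%:E + a%:E * nu E <=
  \int[nu]_(s in Omega d) (excess a (tsum s))%:E.
Proof.
move=> a0 mE EO hE; have mO := @measurable_Omega R d.
rewrite -(integral_sum_marginals hnu.1 hmarg (measurable_excess a) (@excess_ge0 _ a) (excess0 a0)).
have mS : measurable_fun (Omega d)
    (fun s : d.-tuple R => (\sum_(i < d) excess a (tnth s i))%R%:E).
  apply: measurable_funTS; apply/measurable_EFinP; apply: measurable_sum => i.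
  exact: (measurableT_comp (measurable_excess a) (measurable_tnth i)).
have mI : measurable_fun (Omega d) (fun s : d.-tuple R => (\1_E s)%:E : \bar R).
  by apply: measurable_funTS; apply/measurable_EFinP; exact: measurable_indic.
have S0 (s : d.-tuple R) : 0 <= (\sum_(i < d) excess a (tnth s i))%R%:E.
  by rewrite lee_fin sumr_ge0// => i _; exact: excess_ge0.
have I0 (s : d.-tuple R) : 0 <= a%:E * ((\1_E s)%:E : \bar R).
  by rewrite -EFinM lee_fin mulr_ge0.
have -> : a%:E * nu E = \int[nu]_(s in Omega d) (a%:E * (\1_E s)%:E).
  rewrite ge0_integralZl; [|exact: mO|exact: mI|by move=> s _; rewrite lee_fin|by rewrite lee_fin].
  by rewrite integral_indic// setIidl.
rewrite -ge0_integralD//; last exact: measurable_funeM.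
apply: ge0_le_integral => //.
- by move=> s _; rewrite adde_ge0.
- by apply: emeasurable_funD => //; exact: measurable_funeM.
- apply: measurable_funTS; apply/measurable_EFinP.
  exact: (measurableT_comp (measurable_excess a) (@measurable_tsum R d)).
move=> s sO; rewrite -EFinM -EFinD lee_fin indicE.
case: (boolP (s \in E)) => [/[!inE] /hE|_]; first by rewrite mulr1.
by rewrite mulr0 addr0; apply: sum_excess_le => // i; exact: sO.1.
Qed.

(** The bound [level_le] holds for [gp] at any threshold, in particular at that of [g], where [g]
    attains its own bound; only the two excess integrals remain to be compared. *)
Lemma level_le_of_threshold (g gp : {measure set ((d + d).-tuple R) -> \bar R})
    (y a : R) (E : set (d.-tuple R)) :
  couplings nu (nu_co d nubar) g ->
  couplings (nu_perp d nubar) (nu_co d nubar) gp ->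
  (0 < y)%R -> (0 <= a)%R ->
  {ae g, forall z, Omega (d + d) z ->
    ((a < tsum (fst_part z))%R -> (y < height i0 z)%R) /\
    ((y < height i0 z)%R -> (a <= tsum (fst_part z))%R)} ->
  measurable E -> E `<=` Omega d ->
  (forall s, E s -> (\sum_(i < d) excess a (tnth s i) + a <= excess a (tsum s))%R) ->
  level_integral i0 gp y + a%:E * nu E <= level_integral i0 g y.
Proof.
move=> hg hgp y0 a0 ha mE EO hE; have [nub0 _] := hnubar.
apply: le_trans (level_ge nub0 hg y0 a0 ha).
have aE0 : 0 <= a%:E * nu E by rewrite mule_ge0.
apply: (@le_trans _ _ (a%:E * nubar `]y, +oo[%classic +
   \int[nu_perp d nubar]_(s in Omega d) (excess a (tsum s))%:E + a%:E * nu E)).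
  by apply: leeD => //; exact: level_le.
rewrite -addeA leeD2l// integral_excess_nu_perp//.
exact: integral_excess_ge.
Qed.

(** Covers the levels without mass above them, for which no quantile threshold is provided. With [y]
    itself as threshold both terms of [level_le] vanish. *)
Lemma level_perp_eq0 (gp : {measure set ((d + d).-tuple R) -> \bar R}) (y : R) :
  couplings (nu_perp d nubar) (nu_co d nubar) gp -> (0 < y)%R ->
  nubar `]y, +oo[%classic = 0 -> level_integral i0 gp y <= 0.
Proof.
move=> hgp y0 Ny0; have [nub0 _] := hnubar.
apply: (le_trans (level_le i0 nub0 hgp y0 (ltW y0))).
rewrite Ny0 mule0 add0e integral_excess_nu_perp//; last exact: ltW.
rewrite big1// => i _.
have mO1 := @measurable_Omega1 R.
rewrite (@ge0_negligible_integral _ _ _ nubar Omega1 `]y, +oo[%classic)//.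
- apply: integral0_eq => x [x0 /=]; rewrite in_itv/= andbT => /negP; rewrite -leNgt => xy.
  by rewrite /excess max_r// subr_le0.
- apply: measurable_funTS; apply/measurable_EFinP; exact: measurable_excess.
- by move=> x _; rewrite lee_fin excess_ge0.
Qed.

Lemma level_integral_ge0 (g : {measure set ((d + d).-tuple R) -> \bar R}) (y : R) :
  0 <= level_integral i0 g y.
Proof.
apply: integral_ge0 => z zO; rewrite lee_fin; case: ifP => // _.
by apply: tsum_ge0; exact: fst_part_ge0.
Qed.

(** By [cost_identity] each cost plus twice its layer cake integral is the same finite constant, as
    [nu] and [nu_perp] share their marginals. A gap [e] between the levels over [y1, y2] thus
    becomes a cost gap 2 e (y2 - y1). *)
Lemma cost_compare (g gp : {measure set ((d + d).-tuple R) -> \bar R}) (y1 y2 e : R) :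
  couplings nu (nu_co d nubar) g ->
  couplings (nu_perp d nubar) (nu_co d nubar) gp ->
  (0 < y1)%R -> (y1 <= y2)%R -> (0 <= e)%R ->
  (forall y, (0 < y)%R -> level_integral i0 gp y <= level_integral i0 g y) ->
  (forall y, (y1 <= y <= y2)%R ->
     level_integral i0 gp y + e%:E <= level_integral i0 g y) ->
  coupling_cost g + (2 * (e * (y2 - y1)))%R%:E <= coupling_cost gp /\
  coupling_cost g \is a fin_num.
Proof.
move=> hg hgp y10 y12 e0 h0 he; have [nub0 nubfin] := hnubar.
have cg := cost_identity i0 hg; have cgp := cost_identity i0 hgp.
rewrite (coupling_layer_cake i0 hg) in cg; rewrite (coupling_layer_cake i0 hgp) in cgp.
have mg := measurable_level_integral i0 hg; have mgp := measurable_level_integral i0 hgp.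
rewrite (integral_sqnorm hnu.1 hmarg) in cg.
rewrite (integral_sqnorm (@nu_perp_setCOmega R d nubar nub0) (@nu_perp_has_marginals R d nubar)) in cgp.
set K := (X in _ = X) in cg; rewrite -/K in cgp.
have Kfin : K < +oo.
  rewrite /K lte_add_pinfty//; first by apply: lte_sum_pinfty => i _.
  exact: nu_co_sqnorm_fin.
have C0 (m : {measure set ((d + d).-tuple R) -> \bar R}) : 0 <= coupling_cost m.
  by apply: integral_ge0 => z _; rewrite lee_fin sqnorm_ge0.
pose I (m : {measure set ((d + d).-tuple R) -> \bar R}) : \bar R :=
  \int[lebesgue_measure]_(y in `]0%R, +oo[) level_integral i0 m y.
have L0 (m : {measure set ((d + d).-tuple R) -> \bar R}) y : 0 <= level_integral i0 m y.
  exact: level_integral_ge0.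
have I0 m : 0 <= I m by exact: integral_ge0.
have {}cg : coupling_cost g + 2%:E * I g = K := cg.
have {}cgp : coupling_cost gp + 2%:E * I gp = K := cgp.
have Igap : I gp + (e * (y2 - y1))%R%:E <= I g.
  have m12 : measurable (`[y1, y2]%classic : set R) by exact: measurable_itv.
  have -> : (e * (y2 - y1))%R%:E =
      \int[lebesgue_measure]_(y in `]0%R, +oo[) (e%:E * (\1_(`[y1, y2]%classic : set R) y)%:E).
    rewrite ge0_integralZl; [|exact: measurable_itv| |by move=> y _; rewrite lee_fin|by rewrite lee_fin]; last first.
      by apply: measurable_funTS; apply/measurable_EFinP; exact: measurable_indic.
    rewrite integral_indic//= setIidl; last first.
      by move=> y /=; rewrite !in_itv/= andbT => /andP[+ _]; exact: lt_le_trans.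
    rewrite lebesgue_measure_itv/= lte_fin EFinM; congr (_ * _).
    case: ifPn => //; rewrite -leNgt => y21.
    by rewrite (_ : y1 = y2) ?subrr//; apply/eqP; rewrite eq_le y12.
  rewrite /I -ge0_integralD//; last 3 first.
  - by apply: measurable_funTS; exact: mgp.
  - by move=> y _; rewrite -EFinM lee_fin mulr_ge0.
  - by apply: measurable_funTS; apply: measurable_funeM; apply/measurable_EFinP; exact: measurable_indic.
  apply: ge0_le_integral => //.
  - by move=> y _; apply: adde_ge0 => //; rewrite -EFinM lee_fin mulr_ge0.
  - apply: emeasurable_funD; first by apply: measurable_funTS; exact: mgp.
    by apply: measurable_funTS; apply: measurable_funeM; apply/measurable_EFinP; exact: measurable_indic.
  - by apply: measurable_funTS; exact: mg.
  move=> y /=; rewrite in_itv/= andbT => y0.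
  rewrite indicE mem_setE in_itv/=; case: (boolP (y1 <= y <= y2)%R) => yy; last by rewrite mule0 adde0 h0.
  by rewrite mule1 he.
have fin1 (m : {measure set ((d + d).-tuple R) -> \bar R}) :
    coupling_cost m + 2%:E * I m = K ->
    coupling_cost m \is a fin_num /\ I m \is a fin_num.
  move=> cm; split.
    rewrite ge0_fin_numE//; apply: le_lt_trans Kfin; rewrite -cm leeDl//.
    by rewrite mule_ge0.
  rewrite ge0_fin_numE//; apply: le_lt_trans Kfin; rewrite -cm.
  apply: (@le_trans _ _ (2%:E * I m)); last by rewrite leeDr.
  by rewrite lee_pemull// lee_fin ler1n.
have [Cg Ig] := fin1 _ cg; have [Cgp Igp] := fin1 _ cgp.
split => //; move: cg cgp Igap.
rewrite -(fineK Cg) -(fineK Ig) -(fineK Cgp) -(fineK Igp).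
rewrite -!EFinM -!EFinD => <- [] cc; rewrite !lee_fin; lra.
Qed.

End comparison.

(** * Optimality and the uniform gap *)

Section optimality.
Context (R : realType) (d : nat) (i0 : 'I_d).
Variables (nu : {measure set (d.-tuple R) -> \bar R}).
Variables (nubar : {measure set R -> \bar R}).
Hypotheses (hnu : inM2 nu) (hnubar : inM2_1 nubar) (hmarg : has_marginals nu nubar).

(** One coupling [g] beats every [gp], and [e] is chosen before [gp], so the gap survives the
    infimum over couplings. *)
Lemma coupling_cost_gap_exists :
  exists2 g : {measure set ((d + d).-tuple R) -> \bar R},
    couplings nu (nu_co d nubar) g &
    [/\ coupling_cost g < +oo,
      forall gp, couplings (nu_perp d nubar) (nu_co d nubar) gp ->
        coupling_cost g <= coupling_cost gp &
      nubar Omega1 = +oo -> forall i j, i != j -> nu (two_pos i j) != 0 ->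
        exists2 e : R, (0 < e)%R &
          forall gp, couplings (nu_perp d nubar) (nu_co d nubar) gp ->
            coupling_cost g + e%:E <= coupling_cost gp].
Proof.
have [nub0 _] := hnubar; have [nu0 _] := hnu.
have [g hg gthr] := comonotone_coupling_exists i0 hnu hnubar hmarg.
exists g => //.
have base gp y : couplings (nu_perp d nubar) (nu_co d nubar) gp -> (0 < y)%R ->
    level_integral i0 gp y <= level_integral i0 g y.
  move=> hgp y0; have [Ny0|Ny0] := eqVneq (nubar `]y, +oo[%classic) 0.
    by apply: (le_trans (level_perp_eq0 i0 hnubar hgp y0 Ny0)); exact: level_integral_ge0.
  have Ny : 0 < nubar `]y, +oo[%classic by rewrite lt0e Ny0 measure_ge0.
  have [a a0 [_ _ ha]] := gthr y y0 Ny.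
  have := level_le_of_threshold hnu hnubar hmarg hg hgp y0 a0 ha measurable0 (@sub0set _ _).
  by rewrite measure0 mule0 adde0; apply => s [].
split.
- have c0 : coupling_cost g + 2%:E * \int[g]_(z in Omega (d + d)) (tsum (fst_part z) * height i0 z)%:E < +oo.
    rewrite (cost_identity i0 hg) lte_add_pinfty//; first by case: hnu.
    exact: nu_co_sqnorm_fin.
  apply: le_lt_trans c0; rewrite leeDl// mule_ge0//.
  apply: integral_ge0 => z zO; rewrite lee_fin mulr_ge0//.
    by apply: tsum_ge0; exact: fst_part_ge0.
  exact: (snd_part_ge0 zO i0).
- move=> gp hgp.
  (* The degenerate interval [1, 1] with e = 0 yields the plain inequality. *)
  have [|] := @cost_compare R d i0 nu nubar hnu hnubar hmarg g gp 1 1 0 hg hgp ltr01 (lexx _) (lexx _) (fun y => @base gp y hgp).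
    move=> y /andP[y1 _]; rewrite adde0; apply: base => //; exact: lt_le_trans y1.
  by rewrite mul0r mulr0 adde0.
move=> nubT i j ij tpos.
have mO := @measurable_Omega R d; have mtp := @measurable_two_pos R d i j.
pose m (s : d.-tuple R) := Num.min (tnth s i) (tnth s j).
have mm : measurable_fun setT m.
  by apply: measurable_minr; exact: measurable_tnth.
have [eta eta0 Epos] : exists2 eta : R, (0 < eta)%R &
    0 < nu (two_pos i j `&` [set s | (eta <= m s)%R]).
  apply: contrapT => H; move/negP: tpos; apply; rewrite eq_le measure_ge0 andbT.
apply: (@measure_pos_le R _ _ nu (two_pos i j) m 0 mtp mm) => [s [_ /= /andP[si sj]]|t t0].
    by rewrite /m lt_min si.
  by rewrite leNgt; apply/negP => ?; apply: H; exists t.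
pose E := two_pos i j `&` [set s | (eta <= m s)%R].
have mE : measurable E.
  by apply: measurableI => //; apply: measurable_pred; exact: measurable_fun_ler.
have EO : E `<=` Omega d by move=> s [[]].
have [Vfin _] := sum_tail_bounds i0 hnu.
have [Nfin _] := ray_tail_bounds hnubar.
have Vle x y : (x <= y)%R -> sum_tail nu y <= sum_tail nu x.
  move=> xy; apply: le_measure; rewrite ?inE.
  + by apply: measurableI => //; apply: measurable_pred; apply: measurable_fun_ler => //; exact: measurable_tsum.
  + by apply: measurableI => //; apply: measurable_pred; apply: measurable_fun_ler => //; exact: measurable_tsum.
  + by move=> s [sO /= ys]; split => //=; exact: le_trans ys.
have Nle x y : (x <= y)%R -> nubar `]y, +oo[%classic <= nubar `]x, +oo[%classic.
  move=> xy; apply: le_measure; rewrite ?inE; [exact: measurable_itv..|].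
  by move=> t /=; rewrite !in_itv/= !andbT; exact: le_lt_trans.
have Efin : nu E < +oo.
  apply: le_lt_trans (Vfin eta eta0); apply: le_measure; rewrite ?inE//.
    by apply: measurableI => //; apply: measurable_pred; apply: measurable_fun_ler => //; exact: measurable_tsum.
  move=> s [[sO _] /=]; rewrite /m le_min => /andP[ei _]; split => //=.
  apply: (le_trans ei); rewrite /tsum (bigD1 i)//= lerDl.
  by apply: sumr_ge0 => k _; exact: sO.1.
(* Infinite mass makes the tails of [nubar] unbounded near 0. For y <= y2 the tail of [nubar]
   exceeds that of S at [eta], which forces the threshold to be at most [eta], as the gap on [E]
   requires. *)
have [y2 y20 Vy2] : exists2 y : R, (0 < y)%R & sum_tail nu eta < nubar `]y, +oo[%classic.
  apply: contrapT => H.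
  have : nubar Omega1 <= sum_tail nu eta.
    apply: (@measure_pos_le R _ _ nubar Omega1 id) => //; first exact: measurable_Omega1.
    (* Halving [t] fits the closed tail at [t] into an open ray. *)
    move=> t t0; apply: (@le_trans _ _ (nubar `](t / 2)%R, +oo[%classic)).
      apply: le_measure; rewrite ?inE.
      + apply: measurableI; first exact: measurable_Omega1.
        by apply: measurable_pred; exact: measurable_fun_ler.
      + exact: measurable_itv.
      + by move=> x [_ /= tx]; rewrite in_itv/= andbT; lra.
    by rewrite leNgt; apply/negP => ?; apply: H; exists (t / 2)%R => //; lra.
  by rewrite nubT leye_eq => /eqP h; have := Vfin _ eta0; rewrite h ltxx.
pose y1 := (y2 / 2)%R.
have y10 : (0 < y1)%R by rewrite /y1; lra.
have y12 : (y1 < y2)%R by rewrite /y1; lra.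
(* For y >= y1 the tail of [nubar] is below that of S at [a1], which forces the threshold to be at
   least [a1]. Such an [a1] exists because [nu] has infinite mass as well. *)
have [a1 a10 Va1] : exists2 a : R, (0 < a)%R & nubar `]y1, +oo[%classic < sum_tail nu a.
  apply: contrapT => H.
  have OT : nu (Omega d) <= nubar `]y1, +oo[%classic.
    apply: (@measure_pos_le R _ _ nu (Omega d) (@tsum R d)) => //.
    - exact: measurable_tsum.
    - exact: tsum_gt0.
    by move=> t t0; rewrite leNgt; apply/negP => ?; apply: H; exists t.
  have : nubar Omega1 <= nubar `]y1, +oo[%classic.
    apply: (@measure_pos_le R _ _ nubar Omega1 id) => //; first exact: measurable_Omega1.
    move=> t t0; apply: (@le_trans _ _ (nubar `](t / 2)%R, +oo[%classic)).
      apply: le_measure; rewrite ?inE.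
      + apply: measurableI; first exact: measurable_Omega1.
        by apply: measurable_pred; exact: measurable_fun_ler.
      + exact: measurable_itv.
      + by move=> x [_ /= tx]; rewrite in_itv/= andbT; lra.
    apply: le_trans OT; apply: (ray_le_nu_Omega i0 hnu hmarg); lra.
  by rewrite nubT leye_eq => /eqP h; have := Nfin _ y10; rewrite h ltxx.
have Ef : nu E \is a fin_num by rewrite ge0_fin_numE.
(* A lower bound for a nu(E), common to all levels in [y1, y2]. *)
pose e := (a1 * fine (nu E))%R.
have e0 : (0 < e)%R by rewrite /e mulr_gt0// fine_gt0// Epos.
exists (2 * (e * (y2 - y1)))%R; first by do 2?apply: mulr_gt0 => //; rewrite subr_gt0.
move=> gp hgp.
have [|//] := @cost_compare R d i0 nu nubar hnu hnubar hmarg g gp y1 y2 e hg hgp y10 (ltW y12) (ltW e0) (fun y => @base gp y hgp).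
move=> y /andP[y1y yy2].
have y0 : (0 < y)%R := lt_le_trans y10 y1y.
have VN : sum_tail nu eta < nubar `]y, +oo[%classic := lt_le_trans Vy2 (Nle _ _ yy2).
have Ny : 0 < nubar `]y, +oo[%classic by apply: le_lt_trans VN; exact: measure_ge0.
have [a a0 [gtA ltA ha]] := gthr y y0 Ny.
have aeta : (a <= eta)%R.
  rewrite leNgt; apply/negP => /(ltA _ (ltW eta0)); rewrite leNgt.
  by rewrite VN.
have a1a : (a1 <= a)%R.
  rewrite leNgt; apply/negP => /gtA; apply/negP; rewrite -leNgt.
  by apply: (le_trans _ (ltW Va1)); exact: Nle.
have EE s : E s -> (\sum_(i < d) excess a (tnth s i) + a <= excess a (tsum s))%R.
  move=> [[sO _] /=]; rewrite /m le_min => /andP[ei ej].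
  by apply: (sum_excess_gap (i := i) (j := j)) => //; [exact: sO.1|exact: le_trans ei|exact: le_trans ej].
apply: le_trans (level_le_of_threshold hnu hnubar hmarg hg hgp y0 a0 ha mE EO EE).
apply: leeD => //; rewrite /e EFinM fineK//.
by apply: lee_wpmul2r => //; rewrite lee_fin.
Qed.

End optimality.

Theorem mainTheorem3 (R : realType) (d : nat) (hd : (2 <= d)%N)
    (nu : {measure set (d.-tuple R) -> \bar R})
    (nubar : {measure set R -> \bar R})
    (hnu : inM2 nu) (hnubar : inM2_1 nubar) (hmarg : has_marginals nu nubar) :
  Wstar nu (nu_co d nubar) <= Wstar (nu_perp d nubar) (nu_co d nubar) /\
  (nubar Omega1 = +oo ->
    (Wstar nu (nu_co d nubar) = Wstar (nu_perp d nubar) (nu_co d nubar) <->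
     forall A : set (d.-tuple R), measurable A -> nu A = nu_perp d nubar A)).
Proof.
pose i0 : 'I_d := Ordinal (leq_trans (isT : (1 <= 2)%N) hd).
have [g hg [cg_fin cg_le cg_gap]] := coupling_cost_gap_exists i0 hnu hnubar hmarg.
pose costs (nu1 : {measure set (d.-tuple R) -> \bar R}) : set (\bar R) :=
  [set coupling_cost g | g in couplings nu1 (nu_co d nubar)].
have WE (nu1 : {measure set (d.-tuple R) -> \bar R}) :
  Wstar nu1 (nu_co d nubar) = sqrte (ereal_inf (costs nu1)) by [].
have costs_ge0 (nu1 : {measure set (d.-tuple R) -> \bar R}) :
    0 <= ereal_inf (costs nu1).
  apply: le_ereal_inf_tmp => _ [m _ <-].
  by apply: integral_ge0 => z _; rewrite lee_fin sqnorm_ge0.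
have inf_le : ereal_inf (costs nu) <= coupling_cost g.
  by apply: ereal_inf_lbound; exists g.
split; first by rewrite !WE lee_sqrt//; apply: le_ereal_inf_tmp => _ [gp hgp <-];
  exact: le_trans (cg_le gp hgp).
move=> nubT; split => [WW|nuE].
- apply: nu_eq_nu_perp => //; [exact: hnu.1|exact: hnubar.1|].
  move=> i j ij; apply/eqP; apply: contrapT => /negP tpos.
  have [e e0 ge] := cg_gap nubT i j ij tpos.
  have le_perp : coupling_cost g + e%:E <= ereal_inf (costs (nu_perp d nubar)).
    by apply: le_ereal_inf_tmp => _ [gp hgp <-]; exact: ge.
  (* Equal distances would give cost(g) + e <= cost(g), which is impossible as the cost of [g] is
     finite. *)
  have : ereal_inf (costs (nu_perp d nubar)) <= ereal_inf (costs nu).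
    by rewrite -lee_sqrt// -!WE WW.
  move=> /(le_trans le_perp)/le_trans/(_ inf_le).
  have cg0 : 0 <= coupling_cost g by exact: le_trans inf_le.
  have cgf : coupling_cost g \is a fin_num by rewrite ge0_fin_numE.
  by rewrite -(fineK cgf) -EFinD lee_fin gerDl leNgt e0.
- rewrite !WE; congr (sqrte (ereal_inf _)).
  (* Couplings see their marginals on measurable sets only, where [nu] and [nu_perp] agree. *)
  have E : couplings nu (nu_co d nubar) = couplings (nu_perp d nubar) (nu_co d nubar).
    apply/seteqP; split => m [m2 m1 mco]; split => // A mA AO.
      by rewrite m1// nuE.
    by rewrite m1// nuE.
  by rewrite /costs E.
Qed.
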